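(* Let $\alpha,\beta \geq 0$ with $\alpha \neq \beta$, and let $F_1:(0,\infty)^2 \rightarrow (0,\infty)^2$ be the involution given by $$F_1(x,y) = \left(\frac{y(1 + \beta xy)}{1 + \alpha xy},\ \frac{x(1 + \alpha xy)}{1 + \beta xy}\right).$$ Let $X$ and $Y$ be $(0,\infty)$-valued independent random variables with twice-differentiable densities that are strictly positive throughout $(0,\infty)$. Then the random variables $(U,V) := F_1(X,Y)$ are independent if and only if there exist $\lambda\in \mathbb{R}$ and $c_1,c_2 > 0$ such that $$X \sim \mathrm{GIG}(\lambda,c_1\alpha,c_2) \quad\text{and}\quad Y \sim \mathrm{GIG}(\lambda,c_2\beta,c_1),$$ in which case $U \sim \mathrm{GIG}(\lambda,c_2\alpha,c_1)$ and $V \sim \mathrm{GIG}(\lambda,c_1\beta,c_2)$. Hence, if moreover $(U,V)$ has the same distribution as $(X,Y)$, then $X \sim \mathrm{GIG}(\lambda,c\alpha,c)$ and $Y \sim \mathrm{GIG}(\lambda,c\beta,c)$ for some $\lambda\in \mathbb{R}$ and $c > 0$.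
   Context: Generalized inverse Gaussian (GIG) distribution: for $\lambda \in \mathbb{R}$ and $k_1,k_2 \in (0, \infty)$, the generalized inverse Gaussian distribution with parameters $(\lambda,k_1,k_2)$, denoted $\mathrm{GIG}(\lambda,k_1,k_2)$, has density $$\frac{1}{Z}\, x^{\lambda - 1} e^{-k_1x-k_2x^{-1}}\, \mathbf{1}_{(0,\infty)}(x), \qquad x \in \mathbb{R},$$ where $Z = \frac{2K_\lambda(2\sqrt{k_1k_2})}{(k_1/k_2)^{\lambda/2}}$ is the normalizing constant and $K_\lambda$ is the modified Bessel function of the second kind with parameter $\lambda$. *)

(* Defs.v *)
From mathcomp Require Import all_boot all_order all_algebra.
From mathcomp Require Import all_classical all_reals all_analysis.
From mathcomp Require Import ring.

Set Implicit Arguments.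
Unset Strict Implicit.
Unset Printing Implicit Defensive.

Import Order.TTheory GRing.Theory Num.Theory.
Import numFieldNormedType.Exports.

Local Open Scope classical_set_scope.
Local Open Scope ring_scope.

Definition cosh (R : realType) (t : R) : R := (expR t + expR (- t)) / 2.

(* Modified Bessel function of the second kind, in its integral representation
   on the half-line, valid for all real l and all z > 0. *)
Definition besselK (R : realType) (l z : R) : R :=
  \int[lebesgue_measure]_(t in `]0, +oo[) (expR (- (z * cosh t)) * cosh (l * t)).

Definition gig_kernel (R : realType) (l k1 k2 x : R) : R :=
  x `^ (l - 1) * expR (- (k1 * x) - k2 * x^-1).

(* The Bessel formula has no meaning at k1 = 0, where the normalizing constant
   is the integral of the kernel, finite exactly when l < 0. *)
Definition gig_Z (R : realType) (l k1 k2 : R) : R :=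
  if k1 == 0 then
    \int[lebesgue_measure]_(x in `]0, +oo[) gig_kernel l 0 k2 x
  else 2 * besselK l (2 * Num.sqrt (k1 * k2)) / (k1 / k2) `^ (l / 2).

Definition gig_pdf (R : realType) (l k1 k2 : R) : R -> R :=
  (fun x => (gig_Z l k1 k2)^-1 * gig_kernel l k1 k2 x) \_ `]0, +oo[.

Definition has_density (d : measure_display) (T : measurableType d)
    (R : realType) (P : probability T R) (X : T -> R) (f : R -> R) : Prop :=
  [/\ measurable_fun [set: R] f,
      forall x, 0 <= f x &
      forall A : set R, measurable A ->
        P (X @^-1` A) = (\int[lebesgue_measure]_(x in A) (f x)%:E)%E].

(* The parameter k1 = 0 is allowed when l < 0: the law is then the inverse gamma
   distribution with shape - l and scale k2. *)
Definition has_GIG (d : measure_display) (T : measurableType d)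
    (R : realType) (P : probability T R) (X : T -> R) (l k1 k2 : R) : Prop :=
  [/\ 0 < k1 \/ (k1 = 0 /\ l < 0), 0 < k2 & has_density P X (gig_pdf l k1 k2)].

Definition smooth_positive_density (d : measure_display) (T : measurableType d)
    (R : realType) (P : probability T R) (X : T -> R) : Prop :=
  exists f : R -> R, has_density P X f /\
    forall x, 0 < x ->
      [/\ 0 < f x, derivable f x 1 & derivable (derive1 f) x 1].

Definition independent_rv (d : measure_display) (T : measurableType d)
    (R : realType) (P : probability T R) (X Y : T -> R) : Prop :=
  forall A B : set R, measurable A -> measurable B ->
    P (X @^-1` A `&` Y @^-1` B) = (P (X @^-1` A) * P (Y @^-1` B))%E.

Definition same_law (d d' : measure_display) (T : measurableType d)
    (E : measurableType d') (R : realType) (P : probability T R)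
    (X Y : T -> E) : Prop :=
  forall A : set E, measurable A -> P (X @^-1` A) = P (Y @^-1` A).

Definition F1 (R : realType) (a b : R) (p : R * R) : R * R :=
  let: (x, y) := p in
  (y * (1 + b * x * y) / (1 + a * x * y),
   x * (1 + a * x * y) / (1 + b * x * y)).

Lemma F1_gt0 (R : realType) (a b x y : R) :
  0 <= a -> 0 <= b -> 0 < x -> 0 < y ->
  0 < (F1 a b (x, y)).1 /\ 0 < (F1 a b (x, y)).2.
Proof.
move=> a0 b0 x0 y0 /=.
have A : 0 < 1 + a * x * y by rewrite ltr_pwDl// !mulr_ge0// ltW.
have B : 0 < 1 + b * x * y by rewrite ltr_pwDl// !mulr_ge0// ltW.
by split; rewrite divr_gt0// mulr_gt0.
Qed.

Lemma F1K (R : realType) (a b x y : R) :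
  0 <= a -> 0 <= b -> 0 < x -> 0 < y ->
  F1 a b (F1 a b (x, y)) = (x, y).
Proof.
move=> a0 b0 x0 y0 /=.
have A : 1 + a * x * y != 0.
  by rewrite gt_eqF// ltr_pwDl// !mulr_ge0// ltW.
have B : 1 + b * x * y != 0.
  by rewrite gt_eqF// ltr_pwDl// !mulr_ge0// ltW.
have uv c : c * (y * (1 + b * x * y) / (1 + a * x * y)) *
    (x * (1 + a * x * y) / (1 + b * x * y)) = c * x * y.
  by field; rewrite A B.
by rewrite !uv; congr pair; field; rewrite A B.
Qed.

(* Main.v *)
From HB Require Import structures.
Require Import Defs.
From mathcomp Require Import all_boot all_order all_algebra.
From mathcomp Require Import all_classical all_reals all_analysis.
From mathcomp Require Import measurable_realfun ring lra.

Set Implicit Arguments.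
Unset Strict Implicit.
Unset Printing Implicit Defensive.

Import Order.TTheory GRing.Theory Num.Theory.
Import numFieldNormedType.Exports.

Local Open Scope classical_set_scope.
Local Open Scope ring_scope.

(** Write a and b for alpha and beta. The product s = x * y is invariant under
    F1, and F1 (x, y) = (y / r, x * r) with r = (1 + a * s) / (1 + b * s). Passing
    from (x, y) to (u, v) therefore changes one coordinate at a time, each time
    by a dilation whose ratio depends on the other coordinate: y becomes s, then
    x becomes v, then s becomes u. Tonelli's theorem and the behaviour of Lebesgue
    measure under dilations show that F1 preserves Lebesgue measure on the
    quadrant ([quadrant_F1]). Hence, if X and Y have densities p and q, then (U, V)
    has density j (u, v) = p (x) * q (y) with (x, y) = F1 (u, v)
    ([F1_joint_law]).

    Sufficiency is a computation: if p and q are the GIG kernels of the statement,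
    then j is a product of two GIG kernels, one in u and one in v
    ([gig_kernel_F1]), so U and V are independent with the announced laws
    ([gig_F1]).

    Necessity. If U and V are independent, averaging over small boxes and using
    the continuity of j gives j u v * j u' v' = j u v' * j u' v at every point
    ([independent_F1_separable]). So ln (j (u, v)) = ln (p x) + ln (q y) is a
    function of u plus a function of v, and its mixed derivative vanishes. In
    the variables x, y this reads
      G y * (1 + a s) - a s * (1 + b s) * K y =
      F x * (1 + b s) - b s * (1 + a s) * H x,        s = x * y,
    where F and H (resp. G and K) depend on the first two derivatives of ln p
    (resp. ln q) ([mixed_derivative_separated]). This equation is solved
    algebraically: three constants L, c1, c2 account for all its solutions,
    because a solution normalized to vanish at 1 would make the quotient of two
    explicit polynomials in x, y split as a product, which a <> b forbids
    ([separated_eq0], [separated_solution]). Integrating back, p and q are GIG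
    kernels up to constants ([F1_separable_log_gig]), and the finiteness of
    their integrals forces c1 and c2 to be positive ([gig_mass_fin_right],
    [gig_mass_fin_left]).

    That the normalizing constant of the definition is the integral of the kernel
    is obtained by writing the integral against dx / x, which is invariant under
    dilations and under inversion ([haar_inv]): a dilation makes the exponent
    symmetric, the inversion folds the half-line onto [1, +oo[, and x = exp t gives
    the Bessel integral ([gig_mass_bessel]).

    Finally, if (U, V) has the law of (X, Y), then U and V are independent, so the
    first part applies, and the comparison of the two joint densities at
    the point (1, 1) gives c1 = c2 ([same_law_GIG]). *)

(** * Dilations, laws and densities *)

Section scaling.
Context {R : realType}.
Notation mu := (@lebesgue_measure R).
Local Open Scope ereal_scope.

(** The formula [x / x ^ 2] for the inverse keeps the real power [`^ (-1)] away from
    negative arguments, where it is not the inverse. *)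
Lemma measurable_invr : measurable_fun [set: R] (fun x : R => x^-1%R).
Proof.
rewrite (_ : (fun x : R => _) = (fun x => x * (x ^+ 2) `^ (-1))%R); last first.
  apply/funext => x; rewrite powR_inv1 ?sqr_ge0//.
  have [->|x0] := eqVneq x 0%R; first by rewrite invr0 mul0r.
  by field.
apply: measurable_funM => //.
apply: (measurableT_comp (measurable_powR (-1)%R)).
exact: exprn_measurable.
Qed.

Lemma measurable_fun_inv d (T : measurableType d) (f : T -> R) :
  measurable_fun [set: T] f -> measurable_fun [set: T] (fun x => (f x)^-1%R).
Proof. exact: measurableT_comp measurable_invr. Qed.

(** Dilating an interval multiplies its length by the ratio, and Lebesgue measure is
    determined by its values on intervals. The integrand is merely measurable, since
    this is applied to indicators of arbitrary Borel sets. *)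
Lemma ge0_integral_scale (c : R) (g : R -> \bar R) : (0 < c)%R ->
  measurable_fun [set: R] g -> (forall x, 0 <= g x) ->
  \int[mu]_x g x = c%:E * \int[mu]_x g (c * x)%R.
Proof.
move=> c0 mg g0.
have mc : measurable_fun [set: R] ( *%R c : measurableTypeR R -> measurableTypeR R).
  exact: mulrl_measurable.
pose cn := NngNum (ltW c0).
pose nu := mscale cn (pushforward mu ( *%R c : measurableTypeR R -> measurableTypeR R)).
transitivity (\int[nu mc]_x g x); last first.
  rewrite ge0_integral_mscale//=; congr (_ * _).
  by rewrite ge0_integral_pushforward.
apply: eq_measure_integral => A mA _; apply: lebesgue_measure_unique => //= _ [[a b]] _ <-.
rewrite /nu /mscale/= /pushforward /=.
rewrite (_ : _ @^-1` _ = `](a / c)%R, (b / c)%R]%classic); last first.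
  by apply/seteqP; split => x/=; rewrite !in_itv/= ltr_pdivrMr// ler_pdivlMr// [(x * c)%R]mulrC.
rewrite !lebesgue_measure_itv/= !lte_fin ltr_pM2r ?invr_gt0//.
case: ifP => _; last by rewrite mule0.
by rewrite -!EFinD -EFinM; congr EFin; field; rewrite gt_eqF.
Qed.

End scaling.

Section density.
Context {R : realType} d (T : measurableType d) (P : probability T R).
Notation mu := (@lebesgue_measure R).
Notation MR := (measurableTypeR R).
Local Open Scope ereal_scope.

(** By uniqueness, almost everywhere, of the Radon-Nikodym derivative, the density
    [p] can replace it in the change of variables. *)
Lemma ge0_integral_law (X : {RV P >-> MR})
    (p : R -> R) (g : MR -> \bar R) :
  has_density P X p -> measurable_fun [set: MR] g -> (forall x, 0 <= g x) ->
  \int[distribution P X]_x g x = \int[mu]_x (g x * (p x)%:E).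
Proof.
move=> [mp p0 pE] mg g0.
have numu : distribution P X `<< mu.
  move=> A nA B mB BA; rewrite /distribution /pushforward pE//.
  by apply: null_set_integral => //; [exact/measurable_funTS/measurable_EFinP|exact: nA].
rewrite -(Radon_Nikodym_SigmaFinite.change_of_variables numu)//.
have fint := Radon_Nikodym_SigmaFinite.f_integrable numu.
set f := Radon_Nikodym_SigmaFinite.f _ _ in fint *.
have mf : measurable_fun setT f by exact: measurable_int fint.
have mpE : measurable_fun [set: MR] (EFin \o p) by exact/measurable_EFinP.
apply: ae_eq_integral => //.
- exact: emeasurable_funM.
- exact: emeasurable_funM.
apply: ae_eqe_mul2l; apply: integral_ae_eq => //.
move=> E _ mE; rewrite -(Radon_Nikodym_SigmaFinite.f_integral numu mE).
exact: pE.
Qed.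

(** Independence is tested on rectangles, which determine a product measure: the law
    of the pair is the product of the two laws. *)
Lemma ge0_integral_joint (X Y : T -> R) (p q : R -> R) (h : MR * MR -> \bar R) :
  measurable_fun [set: T] X -> measurable_fun [set: T] Y ->
  has_density P X p -> has_density P Y q -> independent_rv P X Y ->
  measurable_fun [set: MR * MR] h -> (forall z, 0 <= h z) ->
  \int[P]_w h (X w, Y w) =
  \int[mu]_x \int[mu]_y (h (x, y) * (p x * q y)%:E).
Proof.
move=> mX mY pX qY ind mh h0.
have [mp p0 _] := pX; have [mq q0 _] := qY.
(* Lebesgue measure lives on [MR], which has the same Borel sets as [R] but is a
   different measurable type: the random variables are repackaged accordingly. *)
pose mkX := isMeasurableFun.Build _ _ _ _ (X : T -> MR) mX.
pose mkY := isMeasurableFun.Build _ _ _ _ (Y : T -> MR) mY.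
pose MX : {mfun T >-> MR} := HB.pack (X : T -> MR) mkX.
pose MY : {mfun T >-> MR} := HB.pack (Y : T -> MR) mkY.
pose XY := (fun w => (X w, Y w)) : T -> MR * MR.
have mXY : measurable_fun [set: T] XY by exact/measurable_fun_pair.
have -> : \int[P]_w h (X w, Y w) = \int[pushforward P XY]_z h z.
  by rewrite ge0_integral_pushforward.
transitivity (\int[distribution P MX \x distribution P MY]_z h z).
  apply: eq_measure_integral => A mA _; apply/esym.
  by apply: (@product_measure_unique _ _ _ _ _ (distribution P MX)
    (distribution P MY) (pushforward P XY)).
rewrite fubini_tonelli1//= (@ge0_integral_law MX p)//; last 2 first.
- exact: measurable_fun_fubini_tonelli_F.
- by move=> x; exact: integral_ge0.
apply: eq_integral => x _; rewrite /fubini_F (@ge0_integral_law MY q)//; last first.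
  exact: measurableT_comp.
have mqE : measurable_fun [set: MR] (EFin \o q) by exact/measurable_EFinP.
rewrite -ge0_integralZr//; last 3 first.
- by apply: emeasurable_funM => //; exact: measurableT_comp.
- by move=> y _; rewrite mule_ge0// lee_fin.
- by rewrite lee_fin.
by apply: eq_integral => y _; rewrite -muleA -EFinM mulrC.
Qed.

End density.

(** * Lebesgue measure on the quadrant is invariant under F1 *)

Section quadrant.
Context {R : realType}.
Notation mu := (@lebesgue_measure R).
Notation MR := (measurableTypeR R).
Local Open Scope ereal_scope.

(** The product of the two coordinates of F1 is [u * v], so it is positive; then so are
    both denominators, and the signs of [u] and [v] can be read off. *)
Lemma F1_quadrant (a b : R) (u v : R) : (0 <= a)%R -> (0 <= b)%R ->
  (0 < (F1 a b (u, v)).1)%R -> (0 < (F1 a b (u, v)).2)%R -> (0 < u)%R /\ (0 < v)%R.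
Proof.
move=> a0 b0 /=.
set A := (1 + a * u * v)%R; set B := (1 + b * u * v)%R => x0 y0.
have A0 : A != 0%R by apply/eqP => A0; move: x0; rewrite A0 invr0 mulr0 ltxx.
have B0 : B != 0%R by apply/eqP => B0; move: y0; rewrite B0 invr0 mulr0 ltxx.
have uv : (0 < u * v)%R.
  rewrite (_ : u * v = (v * B / A) * (u * A / B))%R; last by field; rewrite A0 B0.
  exact: mulr_gt0.
have Ap : (0 < A)%R by rewrite ltr_pwDl// -mulrA mulr_ge0// ltW.
have Bp : (0 < B)%R by rewrite ltr_pwDl// -mulrA mulr_ge0// ltW.
by move: x0 y0; rewrite !pmulr_lgt0 ?invr_gt0.
Qed.

Let r (a b s : R) : R := ((1 + a * s) / (1 + b * s))%R.

Let r_gt0 a b s : (0 <= a)%R -> (0 <= b)%R -> (0 < s)%R -> (0 < r a b s)%R.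
Proof. by move=> a0 b0 s0; rewrite divr_gt0// ltr_pwDl// mulr_ge0// ltW. Qed.

Let measurable_r a b : measurable_fun [set: R] (r a b).
Proof.
apply: measurable_funM; last apply: measurable_fun_inv.
- by apply: measurable_funD => //; exact: mulrl_measurable.
- by apply: measurable_funD => //; exact: mulrl_measurable.
Qed.

(** Each of the three steps freezes one coordinate and dilates the other: first
    [y = s / x], then [x = v / r s], finally [s = v * u]. The iterated integrals are
    exchanged between the steps so that the dilated coordinate is the inner one. *)
Lemma quadrant_F1 (a b : R) (k : MR * MR -> \bar R) :
  (0 <= a)%R -> (0 <= b)%R ->
  measurable_fun [set: MR * MR] k -> (forall z, 0 <= k z) ->
  (forall x y, ~ ((0 < x)%R /\ (0 < y)%R) -> k (x, y) = 0) ->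
  \int[mu]_x \int[mu]_y k (x, y) = \int[mu]_v \int[mu]_u k (F1 a b (u, v)).
Proof.
move=> a0 b0 mk k0 kD.
have m1 : measurable_fun [set: MR * MR] (fst : MR * MR -> R) by exact: measurable_fst.
have m2 : measurable_fun [set: MR * MR] (snd : MR * MR -> R) by exact: measurable_snd.
(* The integrand after one and after two steps, in the variables (x, s) and (s, v).
   The absolute values make both nonnegative on the whole plane. *)
pose k1 (z : MR * MR) := (`|z.1|^-1)%:E * k (z.1, z.2 / z.1)%R.
pose k2 (z : MR * MR) := (`|z.2|^-1)%:E * k (z.2 / r a b z.1, r a b z.1 * z.1 / z.2)%R.
have k10 z : 0 <= k1 z by rewrite mule_ge0// lee_fin invr_ge0.
have k20 z : 0 <= k2 z by rewrite mule_ge0// lee_fin invr_ge0.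
have mk1 : measurable_fun [set: MR * MR] k1.
  apply: emeasurable_funM.
    by apply/measurable_EFinP; apply: measurable_fun_inv; exact: measurableT_comp.
  apply: (measurableT_comp mk); apply/measurable_fun_pair => //=.
  by apply: measurable_funM => //; exact: measurable_fun_inv.
have mk2 : measurable_fun [set: MR * MR] k2.
  have mr1 : measurable_fun [set: MR * MR] (fun z : MR * MR => r a b z.1).
    exact: (measurableT_comp (measurable_r a b)).
  apply: emeasurable_funM.
    by apply/measurable_EFinP; apply: measurable_fun_inv; exact: measurableT_comp.
  apply: (measurableT_comp mk); apply/measurable_fun_pair => //=.
    by apply: measurable_funM => //; exact: measurable_fun_inv.
  apply: measurable_funM; first exact: measurable_funM.
  exact: measurable_fun_inv.
have mpair1 (h : MR * MR -> \bar R) (x : MR) : measurable_fun [set: MR * MR] h ->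
    measurable_fun [set: MR] (fun y => h (x, y)).
  by move=> mh; exact: measurableT_comp.
have mpair2 (h : MR * MR -> \bar R) (y : MR) : measurable_fun [set: MR * MR] h ->
    measurable_fun [set: MR] (fun x => h (x, y)).
  by move=> mh; exact: measurableT_comp.
transitivity (\int[mu]_x \int[mu]_s k1 (x, s)).
  apply: eq_integral => x _; have [x0|x0] := ltP 0%R x; last first.
    rewrite integral0_eq; last by move=> y _; rewrite kD// => -[]; rewrite ltNge x0.
    by rewrite integral0_eq// => y _; rewrite /k1/= kD ?mule0// => -[]; rewrite ltNge x0.
  rewrite (@ge0_integral_scale _ x^-1) ?invr_gt0//; last exact: mpair1.
  rewrite /k1/= ge0_integralZl//; last first.
    by apply: (measurableT_comp mk); apply/measurable_fun_pair => //=; exact: mulrr_measurable.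
  by rewrite gtr0_norm//; congr (_ * _); apply: eq_integral => s _; rewrite mulrC.
transitivity (\int[mu]_s \int[mu]_x k1 (x, s)); first exact: fubini_tonelli.
transitivity (\int[mu]_s \int[mu]_v k2 (s, v)).
  apply: eq_integral => s _; have [s0|s0] := ltP 0%R s; last first.
    rewrite integral0_eq; last first.
      move=> y _; rewrite /k1/= kD ?mule0// => -[y0].
      by rewrite pmulr_lgt0 ?invr_gt0// ltNge s0.
    rewrite integral0_eq// => y _; rewrite /k2/= kD ?mule0// => -[p1 p2].
    have := mulr_gt0 p1 p2.
    set c := r a b s.
    have c0 : c != 0%R by apply/eqP => c0; move: p1; rewrite -/c c0 invr0 mulr0 ltxx.
    have y0 : y != 0%R by apply/eqP => y0; move: p1; rewrite -/c y0 mul0r ltxx.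
    rewrite (_ : (y / c * _)%R = s); first by rewrite ltNge s0.
    by field; rewrite c0 y0.
  rewrite /k2/=; have := r_gt0 a0 b0 s0; move: (r a b s) => c c0.
  rewrite (@ge0_integral_scale _ c^-1) ?invr_gt0//; last exact: mpair2.
  rewrite -ge0_integralZl//; last 2 first.
  - by apply: (measurableT_comp mk1); apply/measurable_fun_pair => //=; exact: mulrl_measurable.
  - by rewrite lee_fin invr_ge0 ltW.
  apply: eq_integral => v _; rewrite /k1/= muleA -EFinM.
  have c1 : (0 < c^-1)%R by rewrite invr_gt0.
  rewrite (_ : c^-1 * `|c^-1 * v|^-1 = `|v|^-1)%R; last first.
    by rewrite normrM (gtr0_norm c1) invfM mulrA divff ?mul1r ?gt_eqF.
  rewrite (_ : (s / (c^-1 * v) = c * s / v)%R); last by rewrite invfM invrK mulrA [(s * c)%R]mulrC.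
  by rewrite [(c^-1 * v)%R]mulrC.
transitivity (\int[mu]_v \int[mu]_s k2 (s, v)); first exact: fubini_tonelli.
apply: eq_integral => v _; have [v0|v0] := ltP 0%R v; last first.
  rewrite integral0_eq; last first.
    move=> s _; rewrite /k2/= kD ?mule0// => -[p1 p2].
    have := mulr_gt0 p1 p2; set c := r a b s.
    have c0 : c != 0%R by apply/eqP => c0; move: p1; rewrite -/c c0 invr0 mulr0 ltxx.
    have y0 : v != 0%R by apply/eqP => y0; move: p1; rewrite -/c y0 mul0r ltxx.
    rewrite (_ : (v / c * _)%R = s); last by field; rewrite c0 y0.
    move=> s0; have := r_gt0 a0 b0 s0; rewrite -/c => cgt0.
    by move: p1; rewrite -/c pmulr_lgt0 ?invr_gt0// ltNge v0.
  rewrite integral0_eq// => u _.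
  rewrite [F1 _ _ _]surjective_pairing kD// => -[p1 p2].
  by have [_] := F1_quadrant a0 b0 p1 p2; rewrite ltNge v0.
rewrite (@ge0_integral_scale _ v)//; last exact: mpair2.
rewrite -ge0_integralZl//; last 2 first.
- by apply: (measurableT_comp mk2); apply/measurable_fun_pair => //=; exact: mulrl_measurable.
- by rewrite lee_fin ltW.
apply: eq_integral => u _; rewrite /k2/= muleA -EFinM gtr0_norm// divff ?gt_eqF// mul1e.
rewrite /r; have -> : (a * u * v = a * (v * u))%R by ring.
have -> : (b * u * v = b * (v * u))%R by ring.
move: (1 + a * (v * u))%R (1 + b * (v * u))%R => A B.
have -> : (v / (A / B) = v * B / A)%R by rewrite invf_div mulrA.
suff -> : (A / B * (v * u) / v = u * A / B)%R by [].
by rewrite (mulrC v u) !mulrA mulfK ?gt_eqF// mulrAC (mulrC A).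
Qed.

End quadrant.

(** * The joint law of the image under F1 *)

Section joint.
Context {R : realType} d (T : measurableType d) (P : probability T R).
Notation mu := (@lebesgue_measure R).
Notation MR := (measurableTypeR R).
Notation D := `]0%R, +oo[%classic.
Local Open Scope ereal_scope.

Lemma measurable_F1 (a b : R) :
  measurable_fun [set: MR * MR] (fun z : MR * MR => (F1 a b z).1 : MR) /\
  measurable_fun [set: MR * MR] (fun z : MR * MR => (F1 a b z).2 : MR).
Proof.
have m1 : measurable_fun [set: MR * MR] (fst : MR * MR -> R) by exact: measurable_fst.
have m2 : measurable_fun [set: MR * MR] (snd : MR * MR -> R) by exact: measurable_snd.
have mc c : measurable_fun [set: MR * MR] (fun z : MR * MR => 1 + c * z.1 * z.2 : R)%R.
  apply: measurable_funD => //; apply: measurable_funM => //.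
  exact: measurable_funM.
split; rewrite /F1.
- rewrite [X in measurable_fun _ X](_ : _ = fun z : MR * MR =>
    (z.2 * (1 + b * z.1 * z.2) * (1 + a * z.1 * z.2)^-1)%R); last by apply/funext => -[].
  apply: measurable_funM; first exact: measurable_funM.
  exact: measurable_fun_inv.
- rewrite [X in measurable_fun _ X](_ : _ = fun z : MR * MR =>
    (z.1 * (1 + a * z.1 * z.2) * (1 + b * z.1 * z.2)^-1)%R); last by apply/funext => -[].
  apply: measurable_funM; first exact: measurable_funM.
  exact: measurable_fun_inv.
Qed.

Lemma measurable_F1_rv (a b : R) (X Y : T -> R) :
  measurable_fun [set: T] X -> measurable_fun [set: T] Y ->
  measurable_fun [set: T] (fun w => (F1 a b (X w, Y w)).1) /\
  measurable_fun [set: T] (fun w => (F1 a b (X w, Y w)).2).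
Proof.
move=> mX mY; have [mF1 mF2] := measurable_F1 a b.
have mXY : measurable_fun [set: T] (fun w => (X w, Y w) : MR * MR).
  exact/measurable_fun_pair.
by split; [exact: (measurableT_comp mF1 mXY)|exact: (measurableT_comp mF2 mXY)].
Qed.

(** The Jacobian is 1 because F1 preserves Lebesgue measure, and F1 is an involution,
    so the density of the image is the old density composed with F1. *)
Lemma F1_joint_law (a b : R) (X Y : T -> R) (p q : R -> R) (A B : set R) :
  (0 <= a)%R -> (0 <= b)%R ->
  measurable_fun [set: T] X -> measurable_fun [set: T] Y ->
  (forall w, 0 < X w)%R -> (forall w, 0 < Y w)%R ->
  has_density P X p -> has_density P Y q -> independent_rv P X Y ->
  measurable A -> measurable B ->
  P ((fun w => (F1 a b (X w, Y w)).1) @^-1` A `&`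
     (fun w => (F1 a b (X w, Y w)).2) @^-1` B) =
  \int[mu]_(v in B `&` D) \int[mu]_(u in A `&` D)
    (p (F1 a b (u, v)).1 * q (F1 a b (u, v)).2)%:E.
Proof.
move=> a0 b0 mX mY X0 Y0 pX qY ind mA mB.
have [mp p0 _] := pX; have [mq q0 _] := qY.
have [mF1 mF2] := measurable_F1 a b.
have m1 : measurable_fun [set: MR * MR] (fst : MR * MR -> R) by exact: measurable_fst.
have m2 : measurable_fun [set: MR * MR] (snd : MR * MR -> R) by exact: measurable_snd.
pose h (z : MR * MR) : \bar R :=
  (\1_(D : set MR) z.1 * \1_(D : set MR) z.2 *
   (\1_(A : set MR) (F1 a b z).1 * \1_(B : set MR) (F1 a b z).2))%:E.
have mI (C : set MR) (f : MR * MR -> MR) : measurable C ->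
    measurable_fun [set: MR * MR] f ->
    measurable_fun [set: MR * MR] (fun z => \1_C (f z) : R).
  by move=> mC mf; apply: measurableT_comp mf; exact: measurable_indic.
have mh : measurable_fun [set: MR * MR] h.
  apply/measurable_EFinP; apply: measurable_funM; apply: measurable_funM; exact: mI.
have h0 z : 0 <= h z by rewrite lee_fin !mulr_ge0.
pose k z := h z * (p z.1 * q z.2)%:E.
have mk : measurable_fun [set: MR * MR] k.
  apply: emeasurable_funM => //; apply/measurable_EFinP.
  by apply: measurable_funM; [exact: (measurableT_comp mp)|exact: (measurableT_comp mq)].
have inD (x : R) : (x \in (D : set R)) = (0 < x)%R.
  by apply/idP/idP; rewrite inE/= in_itv/= andbT.
transitivity (\int[P]_w h (X w, Y w)).
  rewrite -[in LHS](setIT (_ `&` _)) -integral_indic//; last first.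
    have [mU mV] := measurable_F1_rv a b mX mY.
    by apply: measurableI; rewrite -[X in measurable X]setTI; [exact: mU|exact: mV].
  apply: eq_integral => w _; congr EFin; rewrite /h /= !indicE !inD X0 Y0 !mul1r.
  have memp (C : set R) (f : T -> R) : (w \in f @^-1` C) = (f w \in C).
    by apply/idP/idP; rewrite !inE.
  by rewrite in_setI !memp -natrM mulnb.
rewrite (ge0_integral_joint mX mY pX qY ind mh h0) -/k.
rewrite (quadrant_F1 a0 b0 mk); last 2 first.
- by move=> z; rewrite mule_ge0// lee_fin mulr_ge0.
- move=> x y xy; rewrite /k /h/= !indicE !inD.
  by case: ltP => x0; case: ltP => y0; rewrite ?(mul0r,mulr0,mul0e)//; case: xy.
have kF u v : k (F1 a b (u, v)) =
    ((0 < u)%R%:R * (0 < v)%R%:R * ((u \in A)%:R * (v \in B)%:R))%:E *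
    (p (F1 a b (u, v)).1 * q (F1 a b (u, v)).2)%:E.
  rewrite /k /h !indicE !inD -[in RHS]natrM -[in LHS](natrM _ (0 < _)%R) !mulnb.
  have [/andP[u0 v0]|uv] := boolP ((0 < u)%R && (0 < v)%R).
    have [-> ->] := F1_gt0 a0 b0 u0 v0.
    by rewrite F1K.
  rewrite mul0r mul0e; case: andP => [[x0 y0]|]; last by rewrite mul0r mul0e.
  by have [u0 v0] := F1_quadrant a0 b0 x0 y0; rewrite u0 v0 in uv.
rewrite [RHS]integral_mkcond; apply: eq_integral => v _.
rewrite patchE; case: ifPn => [|] vBD.
  move: vBD; rewrite in_setI inD => /andP[vB v0].
  rewrite [RHS]integral_mkcond; apply: eq_integral => u _; rewrite patchE in_setI inD.
  rewrite kF; have [u0|u0] := ltP 0%R u; last by rewrite andbF !(mul0r,mul0e).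
  by rewrite v0 vB andbT !mul1r mulr1; case: (u \in A); rewrite ?mul1e ?mul0e.
rewrite integral0_eq// => u _; rewrite kF.
move: vBD; rewrite in_setI inD negb_and => /orP[/negbTE ->|/negbTE ->].
  by rewrite !mulr0 mul0e.
by rewrite mulr0 !mul0r mul0e.
Qed.
End joint.

(** * Recovering a continuous density from small boxes *)

Section averages.
Context {R : realType}.
Notation mu := (@lebesgue_measure R).
Notation MR := (measurableTypeR R).
Local Open Scope ereal_scope.

Lemma integral_between (A : set R) (m lo hi : R) (g : R -> \bar R) :
  measurable A -> mu A = m%:E -> (0 <= lo)%R ->
  measurable_fun (A : set MR) g -> (forall x, A x -> lo%:E <= g x <= hi%:E) ->
  (lo * m)%:E <= \int[mu]_(x in A) g x <= (hi * m)%:E.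
Proof.
move=> mA Am lo0 mg gb.
rewrite !EFinM -Am -!integral_cst//; apply/andP; split.
- by apply: ge0_le_integral => // x Ax; case/andP: (gb x Ax).
- apply: ge0_le_integral => // x Ax; case/andP: (gb x Ax) => // l1 l2.
  by rewrite (le_trans _ l1)// lee_fin.
Qed.

Lemma lebesgue_measure_centered (x e : R) : (0 < e)%R ->
  mu `[(x - e)%R, (x + e)%R]%classic = (2 * e)%:E.
Proof.
move=> e0; rewrite lebesgue_measure_itv/= lte_fin ifT; last by lra.
by rewrite -EFinD; congr EFin; ring.
Qed.

(** Tonelli's theorem gives this for integrals over the whole line; the indicator of [A]
    is put into the integrand. *)
Lemma measurable_fun_integral_section (A : set MR) (h : MR * MR -> \bar R) :
  measurable A -> measurable_fun [set: MR * MR] h -> (forall z, 0 <= h z) ->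
  measurable_fun [set: MR] (fun y => \int[mu]_(x in A) h (x, y)).
Proof.
move=> mA mh h0; pose g z := (\1_A z.1)%:E * h z.
have mg : measurable_fun [set: MR * MR] g.
  apply: emeasurable_funM => //; apply/measurable_EFinP.
  by apply: (measurableT_comp (measurable_indic mA)); exact: measurable_fst.
rewrite [X in measurable_fun _ X](_ : _ = fun y => \int[mu]_x g (x, y)).
  by apply: measurable_fun_fubini_tonelli_G => // z; rewrite mule_ge0// lee_fin.
apply/funext => y; rewrite integral_mkcond; apply: eq_integral => x _.
by rewrite patchE /g /= indicE; case: ifP; rewrite ?mul1e ?mul0e.
Qed.

(** On a small box [j] lies between [j (u, v) - n] and [j (u, v) + n]. The lower bound
    is cut off at 0 to keep all integrands nonnegative. *)
Lemma cvg_box_average (j : R * R -> R) (u v : R) :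
  measurable_fun [set: MR * MR] (j : MR * MR -> R) -> (forall z, 0 <= j z)%R ->
  {for (u, v), continuous j} ->
  (fine (\int[mu]_(y in `[(v - e)%R, (v + e)%R]) \int[mu]_(x in `[(u - e)%R, (u + e)%R]) (j (x, y))%:E)%E
    / (2 * e) ^+ 2)%R @[e --> 0^'+] --> j (u, v).
Proof.
move=> mj j0 jc; apply/cvgrPdist_le => /= n n0.
have /nbhs_ballP[r /= r0 rj] : \forall z \near (u, v), (`|j (u, v) - j z| <= n)%R.
  by move/cvgrPdist_le : jc; exact.
near=> e.
have e0 : (0 < e)%R by near: e; exact: nbhs_right_gt.
have er : (e < r)%R by near: e; exact: nbhs_right_lt.
set c := j (u, v) in rj *.
have bnd x y : `[(u - e)%R, (u + e)%R]%classic x -> `[(v - e)%R, (v + e)%R]%classic y ->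
    ((Num.max 0 (c - n))%:E <= (j (x, y))%:E <= (c + n)%:E).
  rewrite /= !in_itv/= => /andP[x1 x2] /andP[y1 y2].
  have /= : (`|c - j (x, y)| <= n)%R.
    apply: rj; split => /=; rewrite /ball/= ltr_norml; lra.
  by rewrite !lee_fin ge_max j0/= ler_norml => /andP[h1 h2]; apply/andP; split; lra.
have mje : measurable_fun [set: MR * MR] (EFin \o j : MR * MR -> \bar R).
  exact/measurable_EFinP.
have : ((Num.max 0 (c - n)) * (2 * e) * (2 * e))%:E <=
    \int[mu]_(y in `[(v - e)%R, (v + e)%R]) \int[mu]_(x in `[(u - e)%R, (u + e)%R]) (j (x, y))%:E
    <= ((c + n) * (2 * e) * (2 * e))%:E.
  apply: integral_between => //.
  - exact: lebesgue_measure_centered.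
  - by rewrite mulr_ge0 ?le_max ?lexx// mulr_ge0// ltW.
  - apply: measurable_funTS.
    apply: (measurable_fun_integral_section _ mje) => //.
  - move=> y yB; apply: integral_between => //.
    + exact: lebesgue_measure_centered.
    + by rewrite le_max lexx.
    + by apply: measurable_funTS; exact: (measurableT_comp mje).
    + by move=> x xA; exact: bnd.
set I := integral _ _ _ => /andP[I1 I2].
have If : I \is a fin_num.
  by rewrite fin_numE gt_eqF ?lt_eqF//; [rewrite (le_lt_trans I2)// ltry|rewrite (lt_le_trans _ I1)// ltNyr].
move: I1 I2; rewrite -(fineK If) !lee_fin => I1 I2.
have e2 : (0 < (2 * e) ^+ 2)%R by rewrite exprn_gt0// mulr_gt0.
rewrite ler_distlC.
rewrite ler_pdivlMr// ler_pdivrMr// expr2 ![(_ * (2 * e * (2 * e)))%R]mulrA I2 andbT (le_trans _ I1)//.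
by rewrite !ler_pM2r ?mulr_gt0// le_max lexx orbT.
Unshelve. all: end_near.
Qed.

End averages.

Section box.
Context {R : realType} d (T : measurableType d) (P : probability T R).
Notation mu := (@lebesgue_measure R).
Notation MR := (measurableTypeR R).

Lemma continuous_F1 (a b u v : R) : 0 <= a -> 0 <= b -> 0 < u -> 0 < v ->
  {for (u, v), continuous (fun z : R * R => (F1 a b z).1)} /\
  {for (u, v), continuous (fun z : R * R => (F1 a b z).2)}.
Proof.
move=> a0 b0 u0 v0.
have pos c : 0 <= c -> 1 + c * u * v != 0.
  by move=> c0; rewrite gt_eqF// ltr_pwDl// !mulr_ge0// ltW.
have c1 : {for (u, v), continuous (fst : R * R -> R)} by exact: cvg_fst.
have c2 : {for (u, v), continuous (snd : R * R -> R)} by exact: cvg_snd.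
have cc c : {for (u, v), continuous (fun z : R * R => 1 + c * z.1 * z.2)}.
  apply: (@cvgD _ R^o); first exact: cvg_cst.
  by apply: cvgM => //; apply: cvgM => //; exact: cvg_cst.
split.
- rewrite (_ : (fun z : R * R => (F1 a b z).1) =
      fun z => z.2 * (1 + b * z.1 * z.2) * (1 + a * z.1 * z.2)^-1); last first.
    by apply/funext => -[].
  apply: cvgM; first by apply: cvgM => //; exact: cc.
  by apply: cvgV; [exact: pos|exact: cc].
- rewrite (_ : (fun z : R * R => (F1 a b z).2) =
      fun z => z.1 * (1 + a * z.1 * z.2) * (1 + b * z.1 * z.2)^-1); last first.
    by apply/funext => -[].
  apply: cvgM; first by apply: cvgM => //; exact: cc.
  by apply: cvgV; [exact: pos|exact: cc].
Qed.

(** For small [e] the box lies in the quadrant, and the joint law is an iterated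
    integral over it. *)
Lemma cvg_F1_box (a b : R) (X Y : T -> R) (p q : R -> R) (u v : R) :
  0 <= a -> 0 <= b ->
  measurable_fun [set: T] X -> measurable_fun [set: T] Y ->
  (forall w, 0 < X w) -> (forall w, 0 < Y w) ->
  has_density P X p -> has_density P Y q -> independent_rv P X Y ->
  (forall x, 0 < x -> {for x, continuous p}) ->
  (forall x, 0 < x -> {for x, continuous q}) ->
  0 < u -> 0 < v ->
  fine (P ((fun w => (F1 a b (X w, Y w)).1) @^-1` `[u - e, u + e] `&`
           (fun w => (F1 a b (X w, Y w)).2) @^-1` `[v - e, v + e]))
    / (2 * e) ^+ 2 @[e --> 0^'+] -->
  p (F1 a b (u, v)).1 * q (F1 a b (u, v)).2.
Proof.
move=> a0 b0 mX mY X0 Y0 pX qY ind cp cq u0 v0.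
have [mp p0 _] := pX; have [mq q0 _] := qY.
have [mF1 mF2] := @measurable_F1 R a b.
have [cF1 cF2] := continuous_F1 a0 b0 u0 v0.
have [F10 F20] := F1_gt0 a0 b0 u0 v0.
pose j (z : R * R) := p (F1 a b z).1 * q (F1 a b z).2.
have mj : measurable_fun [set: MR * MR] (j : MR * MR -> R).
  by apply: measurable_funM; [exact: (measurableT_comp mp)|exact: (measurableT_comp mq)].
have j0 z : 0 <= j z by rewrite mulr_ge0.
have cj : {for (u, v), continuous j}.
  apply: cvgM.
  - by apply: (continuous_comp cF1); exact: cp.
  - by apply: (continuous_comp cF2); exact: cq.
apply: cvg_trans (cvg_box_average mj j0 cj); apply: near_eq_cvg; near=> e.
have e0 : 0 < e by near: e; exact: nbhs_right_gt.
have eu : e < u by near: e; exact: nbhs_right_lt.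
have ev : e < v by near: e; exact: nbhs_right_lt.
have mI x : measurable `[x - e, x + e]%classic by exact: measurable_itv.
have -> := F1_joint_law a0 b0 mX mY X0 Y0 pX qY ind (mI u) (mI v).
have itvD x : e < x -> `[x - e, x + e]%classic `&` `]0, +oo[%classic = `[x - e, x + e]%classic.
  move=> ex; apply/setIidPl => y /=; rewrite !in_itv/= andbT => /andP[+ _]; lra.
by rewrite !itvD.
Unshelve. all: end_near.
Qed.

(** With independence, both sides of the identity, taken for probabilities of boxes
    instead of densities, are the product of the same four marginal probabilities.
    The limit is taken along boxes of equal size. *)
Lemma independent_F1_separable (a b : R) (X Y : T -> R) (p q : R -> R) :
  0 <= a -> 0 <= b ->
  measurable_fun [set: T] X -> measurable_fun [set: T] Y ->
  (forall w, 0 < X w) -> (forall w, 0 < Y w) ->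
  has_density P X p -> has_density P Y q -> independent_rv P X Y ->
  (forall x, 0 < x -> {for x, continuous p}) ->
  (forall x, 0 < x -> {for x, continuous q}) ->
  independent_rv P (fun w => (F1 a b (X w, Y w)).1) (fun w => (F1 a b (X w, Y w)).2) ->
  let j u v := p (F1 a b (u, v)).1 * q (F1 a b (u, v)).2 in
  forall u v u' v', 0 < u -> 0 < v -> 0 < u' -> 0 < v' ->
  j u v * j u' v' = j u v' * j u' v.
Proof.
move=> a0 b0 mX mY X0 Y0 pX qY ind cp cq indUV j u v u' v' u0 v0 u'0 v'0.
have lim x y (x0 : 0 < x) (y0 : 0 < y) :=
  @cvg_F1_box a b X Y p q x y a0 b0 mX mY X0 Y0 pX qY ind cp cq x0 y0.
have FF : Filter (0 : R)^'+ by exact: at_right_proper_filter.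
have [mU mV] := measurable_F1_rv a b mX mY.
have mUV e x y :
    measurable ((fun w => (F1 a b (X w, Y w)).1) @^-1` `[x - e, x + e]) /\
    measurable ((fun w => (F1 a b (X w, Y w)).2) @^-1` `[y - e, y + e]).
  split; rewrite -[X in measurable X]setTI; [apply: mU|apply: mV] => //.
have l1 := cvgM (lim u v u0 v0) (lim u' v' u'0 v'0).
have l2 := cvgM (lim u v' u0 v'0) (lim u' v u'0 v0).
apply: (@cvg_unique _ (@Rhausdorff R) _ _ _ _ (l1 FF)); apply: cvg_trans (l2 FF).
apply: near_eq_cvg; near=> e => /=.
have [mu1 mv1] := mUV e u v; have [mu2 mv2] := mUV e u' v'.
rewrite !indUV// !fineM; try exact: fin_num_measure.
move: (fine _) (fine _) (fine _) (fine _) (_^-1) => *; ring.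
Unshelve. all: end_near.
Qed.

End box.

(** * A functional equation without regularity *)

Section algebra.
Context {R : realFieldType}.
Implicit Types a b x y : R.

(** Four points determine a cubic. This replaces a limit at the excluded point 0. *)
Lemma cubic_constant_coef (c0 c1 c2 c3 : R) :
  (forall x, 0 < x < 1 -> c0 + c1 * x + c2 * x ^+ 2 + c3 * x ^+ 3 = 0) -> c0 = 0.
Proof.
move=> h.
have b1 : 0 < (1 / 5 : R) < 1 by apply/andP; split; lra.
have b2 : 0 < (2 / 5 : R) < 1 by apply/andP; split; lra.
have b3 : 0 < (3 / 5 : R) < 1 by apply/andP; split; lra.
have b4 : 0 < (4 / 5 : R) < 1 by apply/andP; split; lra.
have := h _ b1; have := h _ b2; have := h _ b3; have := h _ b4.
lra.
Qed.

(** The equation satisfied by second-order expressions in two functions when the sum of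
    these functions along F1 splits. It is symmetric under exchanging [a], [x], [F], [H]
    with [b], [y], [G], [K]. *)
Definition separated a b (F G H K : R -> R) := forall x y, 0 < x -> 0 < y ->
  G y * (1 + a * (x * y)) - a * (x * y) * (1 + b * (x * y)) * K y =
  F x * (1 + b * (x * y)) - b * (x * y) * (1 + a * (x * y)) * H x.

(** The equations at [y = 1] and [x = 1] express [F] by [H] and [G] by [K]; what remains
    says that [k y * M x y = h x * N x y] with explicit polynomials [M] and [N]. If [h]
    did not vanish, [N / M] would be a product of a function of [x] and one of [y].
    The resulting four-point identity is polynomial, so it extends to the value 0 of one
    of its two arguments [x], then of one of its two arguments [y], and becomes
    [(a - b) * x * y * (1 - a * b * x * y) = 0], which cannot hold for all [y]. *)
Lemma separated_eq0 a b F G H K : 0 < a -> 0 < b -> a != b ->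
  separated a b F G H K -> G 1 = 0 -> K 1 = 0 -> H 1 = 0 ->
  forall x, 0 < x -> [/\ F x = 0, G x = 0, H x = 0 & K x = 0].
Proof.
move=> a0 b0 ab E G1 K1 H1.
have pa x : 0 < x -> 1 + a * x != 0 by move=> x0; rewrite gt_eqF// ltr_pwDl// mulr_ge0// ltW.
have pb x : 0 < x -> 1 + b * x != 0 by move=> x0; rewrite gt_eqF// ltr_pwDl// mulr_ge0// ltW.
have F1 : F 1 = 0.
  have := E 1 1 ltr01 ltr01; rewrite G1 K1 H1 !mulr0 !mulr1 mul0r !subr0 => /esym/eqP.
  by rewrite mulf_eq0 => /orP[/eqP//|/eqP p]; have := pb 1 ltr01; rewrite mulr1 p eqxx.
have FH x : 0 < x -> F x * (1 + b * x) = b * x * (1 + a * x) * H x.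
  by move=> x0; have := E x 1 x0 ltr01; rewrite G1 K1 !mulr1; lra.
have GK y : 0 < y -> G y * (1 + a * y) = a * y * (1 + b * y) * K y.
  by move=> y0; have := E 1 y ltr01 y0; rewrite F1 H1 !mul1r; lra.
pose N x y := 1 + a * x * (1 + y) + a * b * x ^+ 2 * y.
pose M x y := 1 + b * y * (1 + x) + a * b * x * y ^+ 2.
have Npos x y : 0 < x -> 0 < y -> N x y != 0.
  by move=> x0 y0; rewrite gt_eqF// /N !(addr_gt0, mulr_gt0, exprn_gt0).
have Mpos x y : 0 < x -> 0 < y -> M x y != 0.
  by move=> x0 y0; rewrite gt_eqF// /M !(addr_gt0, mulr_gt0, exprn_gt0).
have KH x y : 0 < x -> 0 < y ->
    (a * y * K y * (1 + b * x)) * ((1 - x) * M x y) =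
    (b * x * H x * (1 + a * y)) * ((1 - y) * N x y).
  move=> x0 y0.
  have -> : (a * y * K y * (1 + b * x)) * ((1 - x) * M x y) =
    (1 + b * x) * ((a * y * (1 + b * y) * K y) * (1 + a * (x * y)) -
       a * (x * y) * (1 + b * (x * y)) * K y * (1 + a * y)) by rewrite /M; ring.
  rewrite -GK//.
  have -> : (b * x * H x * (1 + a * y)) * ((1 - y) * N x y) =
    (1 + a * y) * ((b * x * (1 + a * x) * H x) * (1 + b * (x * y)) -
       b * (x * y) * (1 + a * (x * y)) * H x * (1 + b * x)) by rewrite /N; ring.
  rewrite -FH//.
  have := E x y x0 y0.
  move: (G y) (K y) (F x) (H x) => g k f h e.
  have -> : (1 + b * x) * (g * (1 + a * y) * (1 + a * (x * y)) -
    a * (x * y) * (1 + b * (x * y)) * k * (1 + a * y)) =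
    (1 + b * x) * (1 + a * y) * (g * (1 + a * (x * y)) -
    a * (x * y) * (1 + b * (x * y)) * k) by ring.
  by rewrite e; ring.
(* Dividing by [1 - x] and [1 - y] exposes the separation of variables; the point 1,
   where [H] vanishes by assumption, is set aside. *)
pose h x := b * x * H x / ((1 + b * x) * (1 - x)).
pose k y := a * y * K y / ((1 + a * y) * (1 - y)).
have kh x y : 0 < x -> 0 < y -> x != 1 -> y != 1 -> k y * M x y = h x * N x y.
  move=> x0 y0 x1 y1; have := KH x y x0 y0; rewrite /k /h.
  have px : 1 - x != 0 by rewrite subr_eq0 eq_sym.
  have py : 1 - y != 0 by rewrite subr_eq0 eq_sym.
  have := pa _ y0; have := pb _ x0.
  move: (1 + b * x) (1 + a * y) (1 - x) (1 - y) px py (M x y) (N x y) =>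
    A B C D C0 D0 m n A0 B0 e.
  apply: (mulIf (mulf_neq0 (mulf_neq0 A0 B0) (mulf_neq0 C0 D0))).
  transitivity (a * y * K y * A * (C * m)); first by field; rewrite B0 D0.
  by rewrite e; field; rewrite A0 C0.
have h0 x : 0 < x -> x != 1 -> h x = 0.
  move=> x0 x1; apply/eqP; apply: contraT => hx.
  have k_neq0 y : 0 < y -> y != 1 -> k y != 0.
    move=> y0 y1; apply/eqP => ky; have := kh x y x0 y0 x1 y1; rewrite ky mul0r => /esym/eqP.
    by rewrite mulf_eq0 (negbTE hx) (negbTE (Npos _ _ x0 y0)).
  have h_neq0 z : 0 < z -> z != 1 -> h z != 0.
    move=> z0 z1; apply/eqP => hz; have := kh z (1 + 1) z0 ltac:(lra) z1 ltac:(lra); rewrite hz mul0r => /eqP.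
    rewrite mulf_eq0 (negbTE (Mpos _ _ z0 _)) ?orbF; last by lra.
    by rewrite (negbTE (k_neq0 _ _ _))//; lra.
  have cross z y y' : 0 < z -> z != 1 -> 0 < y -> y != 1 -> 0 < y' -> y' != 1 ->
      N x y * N z y' * M x y' * M z y = N x y' * N z y * M x y * M z y'.
    move=> z0 z1 y0 y1 y'0 y'1.
    have [e1 e2 e3 e4] : [/\ k y * M x y = h x * N x y, k y' * M z y' = h z * N z y',
       k y' * M x y' = h x * N x y' & k y * M z y = h z * N z y] by split; apply: kh.
    apply: (mulfI (mulf_neq0 hx (h_neq0 _ z0 z1))).
    apply: (mulfI (mulf_neq0 (k_neq0 _ y0 y1) (k_neq0 _ y'0 y'1))).
    transitivity ((h x * N x y) * (h z * N z y') * (k y' * M x y') * (k y * M z y)); first by ring.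
    rewrite -e1 -e2 e3 e4; ring.
  (* Evaluation at [z = 0]: [N 0 y' = 1] and [M 0 y = 1 + b * y]. The coefficients below
     are those of a cubic in [z]. *)
  have step1 y y' : 0 < y -> y != 1 -> 0 < y' -> y' != 1 ->
      N x y * M x y' * (1 + b * y) = N x y' * M x y * (1 + b * y').
    move=> y0 y1 y'0 y'1; apply/eqP; rewrite -subr_eq0; apply/eqP.
    set n := N x y; set m' := M x y'; set n' := N x y'; set m := M x y.
    pose by1 := a * (1 + y'); pose by2 := a * b * y'.
    pose cy1 := a * (1 + y); pose cy2 := a * b * y.
    pose dy := b * y + a * b * y ^+ 2; pose dy' := b * y' + a * b * y' ^+ 2.
    apply: (@cubic_constant_coef _
      (n * m' * (dy + by1 * (1 + b * y)) - n' * m * (dy' + cy1 * (1 + b * y')))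
      (n * m' * (by1 * dy + by2 * (1 + b * y)) - n' * m * (cy1 * dy' + cy2 * (1 + b * y')))
      (n * m' * (by2 * dy) - n' * m * (cy2 * dy'))) => z /andP[z0 z1].
    have := cross z y y' z0 ltac:(lra) y0 y1 y'0 y'1.
    rewrite -/n -/m -/n' -/m' => /eqP; rewrite -subr_eq0 => /eqP e; rewrite -[RHS]e.
    rewrite /N /M /by1 /by2 /cy1 /cy2 /dy /dy'; ring.
  (* Evaluation at [y' = 0]: [N x 0 = 1 + a * x] and [M x 0 = 1]. *)
  have step2 y : 0 < y -> y != 1 -> N x y * (1 + b * y) = (1 + a * x) * M x y.
    move=> y0 y1; apply/eqP; rewrite -subr_eq0; apply/eqP.
    set n := N x y; set m := M x y.
    apply: (@cubic_constant_coef _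
      (n * (b * (1 + x)) * (1 + b * y) - m * ((a * x + a * b * x ^+ 2) + b * (1 + a * x)))
      (n * (a * b * x) * (1 + b * y) - m * ((a * x + a * b * x ^+ 2) * b)) 0) => z /andP[z0 z1].
    have := step1 y z y0 y1 z0 ltac:(lra).
    rewrite -/n -/m => /eqP; rewrite -subr_eq0 => /eqP e; rewrite -[RHS]e.
    rewrite /N /M; ring.
  have step3 y : 0 < y -> y != 1 -> a * b * x * y = 1.
    move=> y0 y1; have := step2 y y0 y1 => /eqP; rewrite -subr_eq0.
    have -> : N x y * (1 + b * y) - (1 + a * x) * M x y =
      (a - b) * (x * y) * (1 - a * b * x * y) by rewrite /N /M; ring.
    rewrite !mulf_eq0 subr_eq0 (negbTE ab) (gt_eqF x0) (gt_eqF y0)/= subr_eq0.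
    by move=> /eqP.
  have := step3 2 ltac:(lra) ltac:(lra); have := step3 3 ltac:(lra) ltac:(lra).
  lra.
have H0 x : 0 < x -> H x = 0.
  move=> x0; have [->//|x1] := eqVneq x 1.
  have := h0 x x0 x1; rewrite /h => /eqP.
  rewrite !mulf_eq0 invr_eq0 mulf_eq0 (negbTE (pb _ x0)) subr_eq0 [1 == x]eq_sym (negbTE x1).
  by rewrite (gt_eqF x0) (gt_eqF b0) !orbF /= => /eqP.
have K0 y : 0 < y -> K y = 0.
  move=> y0; have := KH 2 y ltac:(lra) y0; rewrite H0; last by lra.
  rewrite mulr0 !mul0r => /eqP.
  rewrite !mulf_eq0 (gt_eqF y0) (gt_eqF a0) (negbTE (pb 2 _))/=; last by lra.
  rewrite (negbTE (Mpos _ _ _ y0))/=; last by lra.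
  by rewrite !orbF => /orP[/eqP//|/eqP]; lra.
move=> x x0; split.
- have := FH x x0; rewrite H0// mulr0 => /eqP.
  by rewrite mulf_eq0 (negbTE (pb _ x0)) orbF => /eqP.
- have := GK x x0; rewrite K0// mulr0 => /eqP.
  by rewrite mulf_eq0 (negbTE (pa _ x0)) orbF => /eqP.
- exact: H0.
- exact: K0.
Qed.

End algebra.

Section solution.
Context {R : realFieldType}.

(** The affine family on the right solves the equation; its three parameters are chosen
    to match [G], [K] and [H] at 1, and [separated_eq0] applies to the difference. When
    [b = 0] the equation does not involve [H], and it is solved directly. *)
Lemma separated_solution (a b : R) F G H K : 0 < a -> 0 <= b -> a != b ->
  separated a b F G H K ->
  exists L c1 c2, forall x, 0 < x ->
    [/\ F x = L - 2 * c1 * a * x, G x = L - 2 * c2 * b * x,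
        K x = L + 2 * c1 / x & b = 0 \/ H x = L + 2 * c2 / x].
Proof.
move=> a0; rewrite le_eqVlt => /orP[/eqP <- _ E|b0 ab E].
  have E' x y (x0 : 0 < x) (y0 : 0 < y) := E x y x0 y0.
  exists (G 1), ((K 1 - G 1) / 2), 0 => x x0.
  have Fx y : 0 < y -> F y = G 1 - (K 1 - G 1) * a * y.
    by move=> y0; have := E' y 1 y0 ltac:(lra); lra.
  have e1 := E' 1 x ltac:(lra) x0; have e2 := E' 2 x ltac:(lra) x0.
  rewrite !Fx in e1 e2; [|lra..].
  have Kx : x * (K x - G x) = K 1 - G 1.
    by apply: (mulfI (lt0r_neq0 a0)); lra.
  have Gx : G x = G 1.
    have : G x + a * (x * (G x - K x)) = G 1 - (K 1 - G 1) * a by lra.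
    by rewrite -Kx; lra.
  split; [|by rewrite Gx; lra| |by left].
  - by rewrite Fx//; field.
  - have -> : 2 * ((K 1 - G 1) / 2) / x = (K 1 - G 1) / x by field; lra.
    by rewrite -Kx Gx; field; lra.
pose L := (G 1 + b * H 1) / (1 + b).
pose c1 := (K 1 - L) / 2; pose c2 := (H 1 - L) / 2.
have b10 : 1 + b != 0 by lra.
have E' : separated a b (fun x => F x - (L - 2 * c1 * a * x))
    (fun x => G x - (L - 2 * c2 * b * x)) (fun x => H x - (L + 2 * c2 / x))
    (fun x => K x - (L + 2 * c1 / x)).
  move=> x y x0 y0 /=.
  have e := E x y x0 y0.
  transitivity (G y * (1 + a * (x * y)) - a * (x * y) * (1 + b * (x * y)) * K y -
    ((L - 2 * c2 * b * y) * (1 + a * (x * y)) - a * (x * y) * (1 + b * (x * y)) * (L + 2 * c1 / y))).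
    by ring.
  rewrite e; field; lra.
exists L, c1, c2 => x x0.
have [|||e1 e2 e3 e4] := separated_eq0 a0 b0 ab E' _ _ _ x0.
- by rewrite /c2 /L; field.
- by rewrite /c1 /L; field.
- by rewrite /c2 /L; field.
by split; [| | |right]; apply/eqP; rewrite -subr_eq0; apply/eqP.
Qed.

End solution.

(** * Functions with zero derivative on the half-line *)

Section calculus.
Context {R : realType}.

(** Composing with the exponential moves the problem to the whole line. *)
Lemma is_derive_pos_cst (f : R -> R) :
  (forall x : R, 0 < x -> is_derive x 1 f 0) -> forall x : R, 0 < x -> f x = f 1.
Proof.
move=> df x x0.
have dg (t : R) : is_derive t (1 : R) (f \o expR) 0.
  have ? := df _ (expR_gt0 t).
  by apply: is_derive_eq; rewrite mul0r.
have := is_derive_0_is_cst (ln x) 0 dg.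
by rewrite /= lnK ?posrE// expR0.
Qed.

Lemma is_derive_near_eq (f g : R -> R) (x df : R) : (\forall y \near x, f y = g y) ->
  is_derive x 1 f df -> is_derive x 1 g df.
Proof.
move=> fg [dfx <-]; split.
  exact: near_eq_derivable fg dfx.
by apply/esym; exact: near_eq_derive.
Qed.

Lemma is_derive_cst_pos (f : R -> R) (x df : R) : 0 < x ->
  (forall y : R, 0 < y -> f y = f 1) -> is_derive x 1 f df -> df = 0.
Proof.
move=> x0 fc fx.
have : is_derive x 1 (cst (f 1)) df.
  apply: is_derive_near_eq fx; near=> y; apply: fc.
  by near: y; exact: lt_nbhsr.
by move=> [_ <-]; rewrite derive_cst.
Unshelve. all: end_near.
Qed.

End calculus.

(** * From separability to logarithms of GIG kernels *)

Section functional.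
Context {R : realType}.

Lemma is_derive_quadratic (c0 c1 c2 x : R) :
  is_derive x 1 (fun y : R => c0 + c1 * y + c2 * y ^+ 2) (c1 + 2 * c2 * x).
Proof.
have d1 := is_deriveZ c1 (is_derive_id x (1 : R^o)).
have d2 := is_deriveZ c2 (is_deriveX 2 (is_derive_id x (1 : R^o))).
have d := is_deriveD (is_deriveD (is_derive_cst (c0 : R^o) x (1 : R^o)) d1) d2.
apply: (is_derive_eq d); rewrite /GRing.scale/=; ring.
Qed.

(** All partial derivatives of the coordinates of F1 needed below are those of quotients
    of polynomials of degree at most 2. *)
Lemma is_derive_quadratic_frac (c0 c1 c2 d0 d1 d2 x : R) :
  d0 + d1 * x + d2 * x ^+ 2 != 0 ->
  is_derive x 1
    (fun y : R => (c0 + c1 * y + c2 * y ^+ 2) / (d0 + d1 * y + d2 * y ^+ 2))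
    (((c1 + 2 * c2 * x) * (d0 + d1 * x + d2 * x ^+ 2) -
      (c0 + c1 * x + c2 * x ^+ 2) * (d1 + 2 * d2 * x)) /
      (d0 + d1 * x + d2 * x ^+ 2) ^+ 2).
Proof.
move=> d_neq0.
have dn := is_derive_quadratic c0 c1 c2 x.
have dd := is_derive_quadratic d0 d1 d2 x.
have dV := @is_deriveV _ (fun y : R => d0 + d1 * y + d2 * y ^+ 2) _ _ _ d_neq0 dd.
have := is_deriveM dn dV => dM; apply: (is_derive_eq dM).
by rewrite /GRing.scale/=; field.
Qed.

(** Four-point form of: the function of (u, v) that sums phi and psi over the two
    coordinates of F1 splits as a function of u plus a function of v. *)
Definition F1_separable (a b : R) (phi psi : R -> R) :=
  let J u v := phi (F1 a b (u, v)).1 + psi (F1 a b (u, v)).2 in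
  forall u v u' v' : R, 0 < u -> 0 < v -> 0 < u' -> 0 < v' ->
  J u v + J u' v' = J u v' + J u' v.

Section differentiate.
Variables (a b : R) (phi phi1 phi2 psi psi1 psi2 : R -> R).
Hypotheses (a0 : 0 <= a) (b0 : 0 <= b) (ab : a != b).
Hypothesis dphi : forall x : R, 0 < x -> is_derive x 1 phi (phi1 x).
Hypothesis dphi1 : forall x : R, 0 < x -> is_derive x 1 phi1 (phi2 x).
Hypothesis dpsi : forall x : R, 0 < x -> is_derive x 1 psi (psi1 x).
Hypothesis dpsi1 : forall x : R, 0 < x -> is_derive x 1 psi1 (psi2 x).

Let X u v := (F1 a b (u, v)).1.
Let Y u v := (F1 a b (u, v)).2.
Let J u v := phi (X u v) + psi (Y u v).

Hypothesis J_sep : F1_separable a b phi psi.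

Let den_neq0 (c u v : R) : 0 <= c -> 0 < u -> 0 < v -> 1 + c * u * v != 0.
Proof. by move=> c0 u0 v0; rewrite gt_eqF// ltr_pwDl// !mulr_ge0// ltW. Qed.

(* Partial derivatives in [u] of the two coordinates of F1. *)
Let Xu (u v : R) := v ^+ 2 * (b - a) / (1 + a * u * v) ^+ 2.
Let Yu (u v : R) := (1 + 2 * a * u * v + a * b * (u * v) ^+ 2) / (1 + b * u * v) ^+ 2.

Let dXu (u v : R) : 0 < u -> 0 < v -> is_derive u 1 (X ^~ v) (Xu u v).
Proof.
move=> u0 v0; have d0 := den_neq0 a0 u0 v0.
have d0' : 1 + a * v * u + 0 * u ^+ 2 != 0 by rewrite mul0r addr0 mulrAC.
have := @is_derive_quadratic_frac v (b * v ^+ 2) 0 1 (a * v) 0 u d0'.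
rewrite (_ : (fun y : R => _) = X ^~ v); last first.
  by apply/funext => y; rewrite /X /F1/=; congr (_ / _); ring.
rewrite (_ : 1 + a * v * u + 0 * u ^+ 2 = 1 + a * u * v); last by ring.
by move=> d; apply: (is_derive_eq d); rewrite /Xu; field.
Qed.

Let dYu (u v : R) : 0 < u -> 0 < v -> is_derive u 1 (Y ^~ v) (Yu u v).
Proof.
move=> u0 v0; have d0 := den_neq0 b0 u0 v0.
have d0' : 1 + b * v * u + 0 * u ^+ 2 != 0 by rewrite mul0r addr0 mulrAC.
have := @is_derive_quadratic_frac 0 1 (a * v) 1 (b * v) 0 u d0'.
rewrite (_ : (fun y : R => _) = Y ^~ v); last first.
  by apply/funext => y; rewrite /Y /F1/=; congr (_ / _); ring.
rewrite (_ : 1 + b * v * u + 0 * u ^+ 2 = 1 + b * u * v); last by ring.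
by move=> d; apply: (is_derive_eq d); rewrite /Yu; field.
Qed.

Let dXv (u v : R) : 0 < u -> 0 < v -> is_derive v 1 (X u)
  ((1 + 2 * b * u * v + a * b * (u * v) ^+ 2) / (1 + a * u * v) ^+ 2).
Proof.
move=> u0 v0; have d0 := den_neq0 a0 u0 v0.
have d0' : 1 + a * u * v + 0 * v ^+ 2 != 0 by rewrite mul0r addr0.
have := @is_derive_quadratic_frac 0 1 (b * u) 1 (a * u) 0 v d0'.
rewrite (_ : (fun y : R => _) = X u); last first.
  by apply/funext => y; rewrite /X /F1/=; congr (_ / _); ring.
rewrite (_ : 1 + a * u * v + 0 * v ^+ 2 = 1 + a * u * v); last by ring.
by move=> d; apply: (is_derive_eq d); field.
Qed.

Let dYv (u v : R) : 0 < u -> 0 < v -> is_derive v 1 (Y u)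
  (u ^+ 2 * (a - b) / (1 + b * u * v) ^+ 2).
Proof.
move=> u0 v0; have d0 := den_neq0 b0 u0 v0.
have d0' : 1 + b * u * v + 0 * v ^+ 2 != 0 by rewrite mul0r addr0.
have := @is_derive_quadratic_frac u (a * u ^+ 2) 0 1 (b * u) 0 v d0'.
rewrite (_ : (fun y : R => _) = Y u); last first.
  by apply/funext => y; rewrite /Y /F1/=; congr (_ / _); ring.
rewrite (_ : 1 + b * u * v + 0 * v ^+ 2 = 1 + b * u * v); last by ring.
by move=> d; apply: (is_derive_eq d); field.
Qed.

Let dXuv (u v : R) : 0 < u -> 0 < v ->
  is_derive v 1 (Xu u) ((b - a) * 2 * v / (1 + a * u * v) ^+ 3).
Proof.
move=> u0 v0; have d0 := den_neq0 a0 u0 v0.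
have d0' : 1 + 2 * a * u * v + (a * u) ^+ 2 * v ^+ 2 != 0.
  rewrite (_ : _ + _ = (1 + a * u * v) ^+ 2); last by ring.
  by rewrite expf_neq0.
have := @is_derive_quadratic_frac 0 0 (b - a) 1 (2 * a * u) ((a * u) ^+ 2) v d0'.
rewrite (_ : (fun y : R => _) = Xu u); last first.
  by apply/funext => y; rewrite /Xu/=; congr (_ / _); ring.
move=> d; apply: (is_derive_eq d).
rewrite (_ : 1 + 2 * a * u * v + (a * u) ^+ 2 * v ^+ 2 = (1 + a * u * v) ^+ 2); last by ring.
by field.
Qed.

Let dYuv (u v : R) : 0 < u -> 0 < v ->
  is_derive v 1 (Yu u) ((a - b) * 2 * u / (1 + b * u * v) ^+ 3).
Proof.
move=> u0 v0; have d0 := den_neq0 b0 u0 v0.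
have d0' : 1 + 2 * b * u * v + (b * u) ^+ 2 * v ^+ 2 != 0.
  rewrite (_ : _ + _ = (1 + b * u * v) ^+ 2); last by ring.
  by rewrite expf_neq0.
have := @is_derive_quadratic_frac 1 (2 * a * u) (a * b * u ^+ 2) 1 (2 * b * u) ((b * u) ^+ 2) v d0'.
rewrite (_ : (fun y : R => _) = Yu u); last first.
  by apply/funext => y; rewrite /Yu/=; congr (_ / _); ring.
move=> d; apply: (is_derive_eq d).
rewrite (_ : 1 + 2 * b * u * v + (b * u) ^+ 2 * v ^+ 2 = (1 + b * u * v) ^+ 2); last by ring.
by field.
Qed.

Let XY_gt0 (u v : R) : 0 < u -> 0 < v -> 0 < X u v /\ 0 < Y u v.
Proof. exact: F1_gt0. Qed.

(* Partial derivative in [u] of the sum. *)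
Let E u v := phi1 (X u v) * Xu u v + psi1 (Y u v) * Yu u v.

Let dJ (u v : R) : 0 < u -> 0 < v -> is_derive u 1 (J ^~ v) (E u v).
Proof.
move=> u0 v0; have [X0 Y0] := XY_gt0 u0 v0.
have d1 := @is_derive1_comp _ phi (X ^~ v) u _ _ (dphi X0) (dXu u0 v0).
have d2 := @is_derive1_comp _ psi (Y ^~ v) u _ _ (dpsi Y0) (dYu u0 v0).
exact: is_deriveD d1 d2.
Qed.

Let E_cst (u v : R) : 0 < u -> 0 < v -> E u v = E u 1.
Proof.
move=> u0 v0; apply/eqP; rewrite -subr_eq0; apply/eqP.
apply: (@is_derive_cst_pos _ (fun u => J u v - J u 1) u) => //.
- move=> y y0; have : J y v + J 1 1 = J y 1 + J 1 v by exact: J_sep.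
  by lra.
- exact: (is_deriveB (dJ u0 v0) (dJ u0 ltr01)).
Qed.

(** The partial derivative of the sum in [u] is independent of [v], so differentiating it
    in [v] gives 0. Since F1 is an involution, [x] and [y] can be taken as
    the variables, and clearing the denominators gives the equation. *)
Lemma mixed_derivative_separated :
  separated a b (fun x => 2 * x * phi1 x + x ^+ 2 * phi2 x)
    (fun y => 2 * y * psi1 y + y ^+ 2 * psi2 y)
    (fun x => - (x ^+ 2 * phi2 x)) (fun y => - (y ^+ 2 * psi2 y)).
Proof.
move=> x y x0 y0.
have [u0 v0] := F1_gt0 a0 b0 x0 y0.
have := F1K a0 b0 x0 y0.
have : exists u v, (u, v) = F1 a b (x, y) by exists (F1 a b (x, y)).1, (F1 a b (x, y)).2.
move=> [u [v uvE]]; rewrite -uvE/= in u0 v0 *.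
have da := den_neq0 a0 u0 v0; have db := den_neq0 b0 u0 v0.
have [X0 Y0] := XY_gt0 u0 v0.
(* The factor in front clears the denominators left after the substitution. *)
have e : (1 + a * u * v) ^+ 2 * (1 + b * u * v) ^+ 2 *
  (phi1 (X u v) * ((b - a) * 2 * v / (1 + a * u * v) ^+ 3) +
   Xu u v * (phi2 (X u v) * ((1 + 2 * b * u * v + a * b * (u * v) ^+ 2) / (1 + a * u * v) ^+ 2)) +
  (psi1 (Y u v) * ((a - b) * 2 * u / (1 + b * u * v) ^+ 3) +
   Yu u v * (psi2 (Y u v) * (u ^+ 2 * (a - b) / (1 + b * u * v) ^+ 2)))) = 0.
  apply/eqP; rewrite mulf_eq0; apply/orP; right; apply/eqP.
  apply: (@is_derive_cst_pos _ (E u) v) => //; first by move=> z z0; exact: E_cst.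
  have d1 := @is_derive1_comp _ phi1 (X u) v _ _ (dphi1 X0) (dXv u0 v0).
  have d2 := @is_derive1_comp _ psi1 (Y u) v _ _ (dpsi1 Y0) (dYv u0 v0).
  exact: is_deriveD (is_deriveM d1 (dXuv u0 v0)) (is_deriveM d2 (dYuv u0 v0)).
move=> [xE yE]; rewrite /X /Y /Xu /Yu /= xE yE in e.
have s : u * v = x * y by rewrite -xE -yE; field; rewrite da db.
have vE : v = x * (1 + a * (x * y)) / (1 + b * (x * y)).
  by rewrite -s -xE !mulrA; field; rewrite da db.
have uE : u = y * (1 + b * (x * y)) / (1 + a * (x * y)).
  by rewrite -s -yE !mulrA; field; rewrite da db.
rewrite -!(mulrA _ u v) s in da db e.
apply: (mulfI (_ : a - b != 0)); first by rewrite subr_eq0.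
apply/eqP; rewrite -subr_eq0 -[X in _ == X]e; apply/eqP.
rewrite {1}uE {1}vE.
move: (phi1 x) (phi2 x) (psi1 y) (psi2 y) => p1 p2 q1 q2.
rewrite ?uE ?vE.
by field; rewrite da db.
Qed.

End differentiate.

(** Exchanging the two parameters of F1 amounts to exchanging the variables in its
    source and in its target. *)
Lemma F1_separableC a b phi psi :
  F1_separable a b phi psi -> F1_separable b a psi phi.
Proof.
move=> J_sep J u v u' v' u0 v0 u'0 v'0.
have JC x y : J x y = phi (F1 a b (y, x)).1 + psi (F1 a b (y, x)).2.
  by rewrite /J /F1/= addrC (mulrAC a x) (mulrAC b x).
by rewrite !JC [RHS]addrC; exact: J_sep.
Qed.

Definition log_gig (k L c d x : R) := k + L * ln x - c * x - d / x.

Lemma derive_log_gig (f f1 : R -> R) (L c d : R) :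
  (forall x : R, 0 < x -> is_derive x 1 f (f1 x)) ->
  (forall x : R, 0 < x -> f1 x = L / x - c + d / x ^+ 2) ->
  exists k, forall x : R, 0 < x -> f x = log_gig k L c d x.
Proof.
move=> df f1E.
exists (f 1 - log_gig 0 L c d 1) => x x0.
pose g y := f y - log_gig 0 L c d y.
suff : g x = g 1 by rewrite /g /log_gig => e; lra.
apply: is_derive_pos_cst => // y y0.
have dln := is_deriveZ L (is_derive1_ln y0).
have did := is_deriveZ c (is_derive_id y (1 : R^o)).
have dinv := is_deriveZ d (@is_deriveV _ id y _ _ (lt0r_neq0 y0) (is_derive_id y (1 : R^o))).
have d0 := is_derive_cst (0 : R^o) y (1 : R^o).
have := is_deriveB (df y y0) (is_deriveB (is_deriveB (is_deriveD d0 dln) did) dinv).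
move=> dg; apply: (is_derive_eq dg).
by rewrite f1E// /GRing.scale/=; field; lra.
Qed.

(** With [phi1] and [phi2] the derivatives of [phi], the solution gives
    [F x = 2 x phi1 + x ^ 2 phi2] and [H x = - x ^ 2 phi2], hence [phi1] from [F + H]. When
    [b = 0] only [F] is known, but it is the derivative of [x ^ 2 * phi1 x]: the
    constant of integration then plays the part of [c2]. *)
Lemma F1_separable_log_gig (a b : R) (phi phi1 phi2 psi psi1 psi2 : R -> R) :
  0 <= a -> 0 <= b -> a != b ->
  (forall x : R, 0 < x -> is_derive x 1 phi (phi1 x)) ->
  (forall x : R, 0 < x -> is_derive x 1 phi1 (phi2 x)) ->
  (forall x : R, 0 < x -> is_derive x 1 psi (psi1 x)) ->
  (forall x : R, 0 < x -> is_derive x 1 psi1 (psi2 x)) ->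
  F1_separable a b phi psi ->
  exists L c1 c2 k1 k2, forall x, 0 < x ->
    phi x = log_gig k1 L (c1 * a) c2 x /\ psi x = log_gig k2 L (c2 * b) c1 x.
Proof.
(* As [a != b], one of the two is positive; [F1_separableC] exchanges them. *)
wlog a_gt0 : a b phi phi1 phi2 psi psi1 psi2 / 0 < a.
  move=> wl a0 b0 ab dphi dphi1 dpsi dpsi1 sep.
  have [ap|a00] := ltP 0 a; first exact: (wl a b phi phi1 phi2 psi psi1 psi2).
  have bp : 0 < b by rewrite lt_def b0 andbT; apply: contra ab => /eqP ->; rewrite eq_le a0 a00.
  have [|L [c1 [c2 [k1 [k2 h]]]]] := wl b a psi psi1 psi2 phi phi1 phi2 bp b0 a0 _ dpsi dpsi1 dphi dphi1 (F1_separableC sep).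
    by rewrite eq_sym.
  by exists L, c2, c1, k2, k1 => x /h[-> ->].
move=> a0 b0 ab dphi dphi1 dpsi dpsi1 sep.
have sepE := mixed_derivative_separated a0 b0 ab dphi dphi1 dpsi dpsi1 sep.
have [L [c1 [c2 h]]] := separated_solution a_gt0 b0 ab sepE.
have psi1E x : 0 < x -> psi1 x = L / x - c2 * b + c1 / x ^+ 2.
  move=> x0; have [_ e1 e2 _] := h x x0.
  have e : 2 * x * psi1 x = 2 * L - 2 * c2 * b * x + 2 * c1 / x by lra.
  apply: (mulfI (_ : 2 * x != 0)); first by lra.
  by rewrite e; field; lra.
have [c phi1E] : exists c, (b == 0) || (c == c2) /\
    forall x, 0 < x -> phi1 x = L / x - c1 * a + c / x ^+ 2.
  have [b00|b_neq0] := eqVneq b 0; last first.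
    exists c2; split; first by rewrite eqxx.
    move=> x x0; have [e1 _ _ [/eqP|e2]] := h x x0; first by rewrite (negbTE b_neq0).
    have e : 2 * x * phi1 x = 2 * L - 2 * c1 * a * x + 2 * c2 / x by lra.
    apply: (mulfI (_ : 2 * x != 0)); first by lra.
    by rewrite e; field; lra.
  pose g x := x ^+ 2 * phi1 x - (0 + L * x + (- (c1 * a)) * x ^+ 2).
  exists (g 1); split => // x x0.
  have : g x = g 1.
    apply: is_derive_pos_cst => // y y0; have [e _ _ _] := h y y0.
    have dX := is_deriveX 2 (is_derive_id y (1 : R^o)).
    have := is_deriveB (is_deriveM dX (dphi1 y y0)) (is_derive_quadratic 0 L (- (c1 * a)) y).
    move=> dg; apply: (is_derive_eq dg).
    transitivity (2 * y * phi1 y + y ^+ 2 * phi2 y - (L - 2 * c1 * a * y)).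
      rewrite (_ : (id ^+ 2 : R -> R) y = y ^+ 2)// /GRing.scale/=; ring.
    by rewrite e subrr.
  rewrite {1}/g => <-; field; lra.
have [k1 k1E] := derive_log_gig dphi phi1E.2.
have [k2 k2E] := derive_log_gig dpsi psi1E.
exists L, c1, c, k1, k2 => x x0; rewrite k1E// k2E//; split => //.
by have [/orP[/eqP ->|/eqP ->]] := phi1E; rewrite ?mulr0.
Qed.

End functional.

(** * The dilation-invariant measure dx / x *)

Section haar.
Context {R : realType}.
Notation mu := (@lebesgue_measure R).
Notation MR := (measurableTypeR R).
Notation D := `]0%R, +oo[%classic.
Local Open Scope ereal_scope.
Implicit Types f g : R -> \bar R.

(** The integral of [f] against the Haar measure of the multiplicative group of positive
    reals. *)
Definition haar f := \int[mu]_(x in D) ((x^-1)%:E * f x).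

Let inD (x : R) : (x \in (D : set R)) = (0 < x)%R.
Proof. by apply/idP/idP; rewrite inE/= in_itv/= andbT. Qed.

Let measurable_invrE : measurable_fun [set: MR] (fun x : R => (x^-1)%:E).
Proof. by apply/measurable_EFinP; exact: measurable_invr. Qed.

Let integrand_ge0 f x : (forall x, (0 < x)%R -> 0 <= f x) -> D x -> 0 <= (x^-1)%:E * f x.
Proof. by rewrite /= in_itv/= andbT => f0 x0; rewrite mule_ge0 ?f0// lee_fin invr_ge0 ltW. Qed.

Lemma eq_haar f g : (forall x, (0 < x)%R -> f x = g x) -> haar f = haar g.
Proof. by move=> fg; apply: eq_integral => x; rewrite inD => x0; rewrite fg. Qed.

Lemma haar_ge0 f : (forall x, (0 < x)%R -> 0 <= f x) -> 0 <= haar f.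
Proof. by move=> f0; apply: integral_ge0 => x; exact: integrand_ge0. Qed.

Lemma haar_scale (c : R) f : (0 < c)%R -> measurable_fun [set: MR] f ->
  (forall x, 0 <= f x) -> haar f = haar (fun x => f (c * x)%R).
Proof.
move=> c0 mf f0; rewrite /haar [LHS]integral_mkcond [RHS]integral_mkcond.
rewrite (@ge0_integral_scale _ c)//; last 2 first.
- apply/(measurable_restrictT _ _).1 => //; apply: measurable_funTS.
  exact: emeasurable_funM.
- by move=> x; rewrite patchE inD; case: ifPn => // x0; rewrite mule_ge0// lee_fin invr_ge0 ltW.
rewrite -ge0_integralZl//; last 3 first.
- apply: (@measurableT_comp _ _ _ _ _ _ ((fun x => (x^-1)%:E * f x) \_ D)) => //.
  apply/(measurable_restrictT _ _).1 => //; apply: measurable_funTS.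
  exact: emeasurable_funM.
- by move=> x _; rewrite patchE inD; case: ifPn => // x0; rewrite mule_ge0// lee_fin invr_ge0 ltW.
- by rewrite lee_fin ltW.
apply: eq_integral => x _; rewrite !patchE !inD pmulr_rgt0//.
case: ifP => x0; last by rewrite mule0.
by rewrite muleA -EFinM invfM mulrA divff ?mul1r// gt_eqF.
Qed.

Lemma haar_fubini (F : MR * MR -> \bar R) :
  measurable_fun [set: MR * MR] F -> (forall z, 0 <= F z) ->
  haar (fun x => haar (fun y => F (x, y))) = haar (fun y => haar (fun x => F (x, y))).
Proof.
move=> mF F0.
pose G (z : MR * MR) := (\1_(D : set MR) z.1 * \1_(D : set MR) z.2 *
  `|z.1|^-1 * `|z.2|^-1)%:E * F z.
have m1 : measurable_fun [set: MR * MR] (fst : MR * MR -> R) by exact: measurable_fst.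
have m2 : measurable_fun [set: MR * MR] (snd : MR * MR -> R) by exact: measurable_snd.
have mI (f : MR * MR -> MR) : measurable_fun [set: MR * MR] f ->
    measurable_fun [set: MR * MR] (fun z => \1_(D : set MR) (f z) : R).
  by move=> mf; apply: measurableT_comp mf; exact: measurable_indic.
have mV (f : MR * MR -> MR) : measurable_fun [set: MR * MR] f ->
    measurable_fun [set: MR * MR] (fun z => `|f z|^-1 : R)%R.
  by move=> mf; apply: measurable_fun_inv; exact: measurableT_comp.
have mG : measurable_fun [set: MR * MR] G.
  apply: emeasurable_funM => //; apply/measurable_EFinP.
  apply: measurable_funM; last exact: mV.
  apply: measurable_funM; last exact: mV.
  by apply: measurable_funM; exact: mI.
have G0 z : 0 <= G z by rewrite mule_ge0// lee_fin !mulr_ge0// invr_ge0.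
have GE1 x : (0 < x)%R -> \int[mu]_y G (x, y) = (x^-1)%:E * haar (fun y => F (x, y)).
  move=> x0; rewrite /haar -ge0_integralZl//; last 3 first.
  - by apply: emeasurable_funM; apply: measurable_funTS => //; exact: measurableT_comp.
  - by move=> y; apply: (@integrand_ge0 (fun y => F (x, y))) => *; exact: F0.
  - by rewrite lee_fin invr_ge0 ltW.
  rewrite [RHS]integral_mkcond; apply: eq_integral => y _.
  rewrite patchE inD /G/= !indicE !inD x0 mul1r; case: ltP => y0.
    by rewrite mul1r !gtr0_norm// muleA -EFinM.
  by rewrite !mul0r mul0e.
have GE2 y : (0 < y)%R -> \int[mu]_x G (x, y) = (y^-1)%:E * haar (fun x => F (x, y)).
  move=> y0; rewrite /haar -ge0_integralZl//; last 3 first.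
  - by apply: emeasurable_funM; apply: measurable_funTS => //; exact: measurableT_comp.
  - by move=> x; apply: (@integrand_ge0 (fun x => F (x, y))) => *; exact: F0.
  - by rewrite lee_fin invr_ge0 ltW.
  rewrite [RHS]integral_mkcond; apply: eq_integral => x _.
  rewrite patchE inD /G/= !indicE !inD y0 mulr1; case: ltP => x0.
    by rewrite mul1r !gtr0_norm// muleA -EFinM [(y^-1 * _)%R]mulrC.
  by rewrite !mul0r mul0e.
transitivity (\int[mu]_x \int[mu]_y G (x, y)).
  rewrite {1}/haar [LHS]integral_mkcond; apply: eq_integral => x _.
  rewrite patchE inD; case: ltP => x0; first by rewrite GE1.
  by rewrite integral0_eq// => y _; rewrite /G/= indicE inD ltNge x0/= !mul0r mul0e.
transitivity (\int[mu]_y \int[mu]_x G (x, y)); first exact: fubini_tonelli.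
rewrite {1}/haar [RHS]integral_mkcond; apply: eq_integral => y _.
rewrite patchE inD; case: ltP => y0; first by rewrite GE2.
by rewrite integral0_eq// => x _; rewrite /G/= !indicE !inD [(0 < y)%R]ltNge y0/= mulr0 !mul0r mul0e.
Qed.

Lemma haarZl (c : \bar R) f : 0 <= c -> measurable_fun [set: MR] f -> (forall x, 0 <= f x) ->
  haar (fun x => c * f x) = c * haar f.
Proof.
move=> c0 mf f0; rewrite /haar -ge0_integralZl//.
- by apply: eq_integral => x _; rewrite muleCA.
- by apply: emeasurable_funM; exact: measurable_funTS.
- by move=> x; exact: integrand_ge0.
Qed.

(** Unimodularity: with [h] of integral 1, compute in two ways the integral of
    [f y * h (x * y)] over [x] and [y]. Dilating [x] by [y] gives the left side; dilating
    [y] by [1 / x], then [x] by [y], gives the right side. *)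
Lemma haar_inv f : measurable_fun [set: MR] f -> (forall x, 0 <= f x) ->
  haar f = haar (fun x => f x^-1%R).
Proof.
move=> mf f0.
pose h (x : R) : \bar R := (`|x| * \1_(`[1%R, 2%R] : set MR) x)%:E.
have h0 x : 0 <= h x by rewrite lee_fin mulr_ge0.
have mh : measurable_fun [set: MR] h.
  by apply/measurable_EFinP; apply: measurable_funM => //; exact: measurable_indic.
have hh : haar h = 1.
  rewrite /haar integral_mkcond (_ : _ \_ _ = EFin \o \1_`[1%R, 2%R]).
    rewrite integral_indic//= setIT lebesgue_measure_itv/= lte_fin ltr1n -EFinD.
    by congr EFin; lra.
  apply/funext => x; rewrite patchE inD /h /= indicE; case: ifP => x0.
    by rewrite gtr0_norm// -EFinM mulrA mulVf ?mul1r// gt_eqF.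
  rewrite memNset//= in_itv/= => /andP[x1 _].
  by rewrite (lt_le_trans ltr01 x1) in x0.
have mfV : measurable_fun [set: MR] (fun x => f x^-1%R).
  by apply: (measurableT_comp mf); exact: measurable_invr.
have m1 : measurable_fun [set: MR * MR] (fst : MR * MR -> R) by exact: measurable_fst.
have m2 : measurable_fun [set: MR * MR] (snd : MR * MR -> R) by exact: measurable_snd.
pose F (z : MR * MR) : \bar R := f z.2 * h (z.1 * z.2)%R.
pose F' (z : MR * MR) : \bar R := f (z.2 / z.1)%R * h z.2.
have mF : measurable_fun [set: MR * MR] F.
  apply: emeasurable_funM; first exact: measurableT_comp.
  by apply: (measurableT_comp mh); exact: measurable_funM.
have mF' : measurable_fun [set: MR * MR] F'.
  apply: emeasurable_funM; last exact: measurableT_comp.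
  by apply: (measurableT_comp mf); apply: measurable_funM => //; exact: measurable_fun_inv.
have F0 z : 0 <= F z by rewrite mule_ge0.
have F'0 z : 0 <= F' z by rewrite mule_ge0.
have ms (g : R -> \bar R) (c : R) : measurable_fun [set: MR] g ->
    measurable_fun [set: MR] (fun x => g (x * c)%R).
  by move=> mg; apply: (measurableT_comp mg); exact: mulrr_measurable.
rewrite -[LHS]mule1 -hh muleC -haarZl ?haar_ge0//.
transitivity (haar (fun y => haar (fun x => F (x, y)))).
  apply: eq_haar => y y0; rewrite (haar_scale y0 mh h0) muleC -haarZl//.
  - by apply: eq_haar => x x0; rewrite /F /= mulrC.
  - by under eq_fun do rewrite mulrC; exact: ms.
rewrite -haar_fubini//.
transitivity (haar (fun x => haar (fun y => F' (x, y)))).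
  apply: eq_haar => x x0; rewrite (haar_scale (_ : 0 < x^-1)%R) ?invr_gt0//.
  - apply: eq_haar => y y0; rewrite /F /F'/=.
    by rewrite [(x * _)%R]mulrA divff ?gt_eqF// mul1r mulrC.
  - exact: (measurableT_comp mF).
rewrite haar_fubini//.
transitivity (haar (fun y => h y * haar (fun x => f x^-1%R))); last first.
  under eq_haar do rewrite muleC.
  rewrite haarZl//; last by apply: haar_ge0.
  by rewrite hh mule1.
apply: eq_haar => y y0; rewrite (haar_scale y0)//; last exact: (measurableT_comp mF').
rewrite -haarZl//; apply: eq_haar => x x0.
rewrite /F'/= muleC; congr (_ * f _).
by rewrite invfM mulrA divff ?mul1r ?gt_eqF.
Qed.

End haar.

(** * Substituting the logarithm *)

Section log_substitution.
Context {R : realType}.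
Notation mu := (@lebesgue_measure R).
Notation MR := (measurableTypeR R).
Implicit Types x : R.

Lemma derive1_ln x : 0 < x -> derive1 (@ln R) x = x^-1.
Proof. by move=> x0; rewrite derive1E; have [_ ->] := is_derive1_ln x0. Qed.

Lemma cvg_ln_pinfty : (@ln R) x @[x --> +oo] --> +oo.
Proof.
apply/cvgryPgt => A; near=> x.
have x0 : 0 < x by near: x; exact: nbhs_pinfty_gt.
by rewrite -ltr_expR lnK ?posrE//.
Unshelve. all: end_near. Qed.

(** The logarithm, rather than the exponential, is taken as the substituted function
    because its derivative has a finite limit at [+oo]. *)
Lemma integral_log_subst (G : R -> R) : continuous G -> (forall t, 0 <= G t) ->
  (\int[mu]_(x in `[1%R, +oo[) (x^-1 * G (ln x))%:E = \int[mu]_(t in `[0%R, +oo[) (G t)%:E)%E.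
Proof.
move=> cG G0.
have dln x : 0 < x -> \forall y \near x, y^-1 = derive1 (@ln R) y.
  by move=> x0; near=> y; rewrite derive1_ln//; near: y; exact: lt_nbhsr.
have cinv x : 0 < x -> {for x, continuous (@GRing.inv R)}.
  by move=> x0; apply: inv_continuous; rewrite gt_eqF.
rewrite -(@ln1 R) (@increasing_ge0_integration_by_substitutiony _ (@ln R) G 1).
- apply: eq_integral => x; rewrite inE/= in_itv/= andbT => x1.
  by rewrite /GRing.mul/= derive1_ln ?(lt_le_trans ltr01)// mulrC.
- move=> x y; rewrite !in_itv/= !andbT => x1 y1 xy.
  by rewrite ltr_ln// posrE (lt_le_trans ltr01).
- move=> x; rewrite in_itv/= andbT => x1; have x0 := lt_trans ltr01 x1.
  rewrite /continuous_at derive1_ln//; apply: cvg_trans (cinv _ x0).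
  by apply: near_eq_cvg; exact: dln.
- apply/cvg_ex; exists 1; rewrite -[X in _ --> X]invr1.
  apply: cvg_at_right_filter; apply: cvg_trans (cinv _ ltr01).
  by apply: near_eq_cvg; exact: dln.
- apply/cvg_ex; exists 0.
  apply: (@cvg_trans _ ((fun x : R => x^-1) @ +oo)).
    by apply: near_eq_cvg; near=> x; rewrite derive1_ln.
  have pos : \forall x \near +oo, 0 < (idfun : R -> R) x by exact: nbhs_pinfty_gt.
  by apply/(gtr0_cvgV0 pos); exact: cvg_id.
- split.
  + move=> x; rewrite in_itv/= andbT => x1.
    by have [] := is_derive1_ln (lt_trans ltr01 x1).
  + apply: cvg_at_right_filter; exact: continuous_ln.
- exact: cvg_ln_pinfty.
- exact: continuous_subspaceT.
- by move=> x _.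
Unshelve. all: end_near. Qed.

End log_substitution.

(** * The total mass of the GIG kernel *)

Section gig_mass.
Context {R : realType}.
Notation mu := (@lebesgue_measure R).
Notation MR := (measurableTypeR R).
Notation D := `]0%R, +oo[%classic.
Implicit Types l k x : R.

Definition gig_mass l (k1 k2 : R) : \bar R :=
  (\int[mu]_(x in D) (gig_kernel l k1 k2 x)%:E)%E.

(** The density of the GIG kernel with respect to [dx / x]; inversion exchanges [k1] and
    [k2] and negates [l]. *)
Definition gig_weight l (k1 k2 : R) x := x `^ l * expR (- (k1 * x) - k2 * x^-1).

Lemma gig_kernel_ge0 l k1 k2 x : 0 <= gig_kernel l k1 k2 x.
Proof. by rewrite mulr_ge0 ?powR_ge0 ?expR_ge0. Qed.

Lemma measurable_exp_part (k1 k2 : R) :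
  measurable_fun [set: R] (fun x : R => expR (- (k1 * x) - k2 * x^-1)).
Proof.
apply: measurableT_comp; first exact: measurable_expR.
apply: measurable_funD; first by apply: measurable_funN; exact: mulrl_measurable.
by apply: measurable_funN; apply: measurable_funM => //; exact: measurable_invr.
Qed.

Lemma measurable_gig_kernel l k1 k2 : measurable_fun [set: R] (gig_kernel l k1 k2).
Proof. by apply: measurable_funM; [exact: measurable_powR|exact: measurable_exp_part]. Qed.

Lemma measurable_gig_weight l k1 k2 : measurable_fun [set: R] (gig_weight l k1 k2).
Proof. by apply: measurable_funM; [exact: measurable_powR|exact: measurable_exp_part]. Qed.

Lemma gig_weight_ge0 l k1 k2 x : 0 <= gig_weight l k1 k2 x.
Proof. by rewrite mulr_ge0 ?powR_ge0 ?expR_ge0. Qed.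

Lemma gig_kernelE l k1 k2 x : 0 < x -> gig_kernel l k1 k2 x = x^-1 * gig_weight l k1 k2 x.
Proof.
move=> x0; rewrite /gig_kernel /gig_weight mulrA [x^-1 * _]mulrC.
by rewrite powRB ?powRr1 ?(ltW x0)// (gt_eqF x0) implybT.
Qed.

Lemma gig_mass_haar l k1 k2 : gig_mass l k1 k2 = haar (EFin \o gig_weight l k1 k2).
Proof.
apply: eq_integral => x; rewrite inE/= in_itv/= andbT => x0.
by rewrite gig_kernelE.
Qed.

Lemma gig_weight_inv l k1 k2 x : 0 < x ->
  gig_weight l k1 k2 x^-1 = gig_weight (- l) k2 k1 x.
Proof.
move=> x0; rewrite /gig_weight -powR_inv1 ?ltW// -powRrM mulN1r powRN powR_inv1 ?ltW//.
by rewrite invrK [in LHS]addrC.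
Qed.

Let mwE l k1 k2 : measurable_fun [set: MR] (EFin \o gig_weight l k1 k2).
Proof. by apply/measurable_EFinP; exact: measurable_gig_weight. Qed.

Lemma gig_mass_inv l k1 k2 : gig_mass l k1 k2 = gig_mass (- l) k2 k1.
Proof.
rewrite (gig_mass_haar l) (gig_mass_haar (- l)) (haar_inv (mwE l k1 k2)); last first.
  by move=> x; rewrite lee_fin gig_weight_ge0.
by apply: eq_haar => x x0 /=; rewrite gig_weight_inv.
Qed.

(** In terms of [t = ln x], the exponent is [l * t - k1 * exp t] up to a bounded term;
    for [k1 < 0] the exponential dominates any linear term. *)
Lemma gig_weight_bounded_below l k1 k2 : k1 < 0 \/ (k1 = 0 /\ 0 <= l) ->
  exists2 c : R, 0 < c & forall x, 1 <= x -> c <= gig_weight l k1 k2 x.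
Proof.
move=> H.
have k2x x : 1 <= x -> - `|k2| <= - (k2 * x^-1).
  move=> x1; have x0 := lt_le_trans ltr01 x1.
  rewrite lerN2 (le_trans (ler_norm _))// normrM ler_piMr// gtr0_norm ?invr_gt0//.
  by rewrite invf_le1.
have xl x : 1 <= x -> x `^ l = expR (l * ln x).
  by move=> x1; rewrite /powR gt_eqF// (lt_le_trans ltr01).
case: H => [k1n|[-> l0]].
  (* The tangent bound [ln (dl * x) <= dl * x - 1] is used with a slope [dl] small enough
     for [|l| * dl <= - k1]. *)
  pose dl := - k1 / (`|l| + 1).
  have l1 : 0 < `|l| + 1 by rewrite ltr_wpDl.
  have dl0 : 0 < dl by rewrite divr_gt0// oppr_gt0.
  exists (expR (`|l| * (1 + ln dl) - `|k2|)) => [|x x1]; first exact: expR_gt0.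
  have x0 := lt_le_trans ltr01 x1.
  rewrite /gig_weight xl// -expRD ler_expR.
  have lnx : 0 <= ln x by exact: ln_ge0.
  have e1 : - `|l| * ln x <= l * ln x by rewrite ler_wpM2r// lerNl -normrN ler_norm.
  have e2 : ln dl + ln x <= dl * x - 1.
    have <- : ln (dl * x) = ln dl + ln x by rewrite lnM ?posrE.
    by have := @le_ln1Dx _ (dl * x - 1); rewrite addrCA subrr addr0; apply; rewrite ltrBrDl subrr mulr_gt0.
  have e3 : `|l| * (ln dl + ln x) <= `|l| * (dl * x - 1) by rewrite ler_wpM2l.
  have e4 : `|l| * dl <= - k1.
    by rewrite /dl mulrCA ler_piMr ?oppr_ge0 1?ltW// ltr_pdivrMr// mul1r ltrDl.
  have e5 : `|l| * dl * x <= - k1 * x by rewrite ler_wpM2r// ltW.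
  have := k2x x x1; lra.
exists (expR (- `|k2|)) => [|x x1]; first exact: expR_gt0.
rewrite /gig_weight xl// -expRD ler_expR mul0r oppr0 add0r.
have lnx : 0 <= ln x by exact: ln_ge0.
by rewrite (le_trans (k2x x x1))// lerDr mulr_ge0.
Qed.

(** Otherwise the weight exceeds a positive constant on [1, +oo[, where [dx / x] has
    infinite mass. *)
Lemma gig_mass_fin_right l k1 k2 : (gig_mass l k1 k2 < +oo)%E ->
  0 < k1 \/ (k1 = 0 /\ l < 0).
Proof.
move=> fin; have [[k10 l0]|H] := pselect (k1 = 0 /\ l < 0); first by right.
have [k10|k10] := ltP 0 k1; first by left.
have [|c c0 cw] := @gig_weight_bounded_below l k1 k2.
  move: k10; rewrite le_eqVlt => /predU1P[k10|k10]; last by left.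
  by right; split => //; rewrite leNgt; apply/negP => l0; apply: H.
suff : (+oo <= gig_mass l k1 k2)%E by rewrite leNgt fin.
have -> : (+oo = \int[mu]_(x in `[1%R, +oo[) (x^-1 * c)%:E)%E.
  rewrite (@integral_log_subst _ (cst c))//; last 2 first.
  - exact: cst_continuous.
  - by move=> t; exact: ltW.
  transitivity (c%:E * mu `[0%R, +oo[)%E; last by rewrite -integral_cst.
  by rewrite lebesgue_measure_itv/= ltry addye// gt0_muley// lte_fin.
apply: (@le_trans _ _ (\int[mu]_(x in `[1%R, +oo[) (gig_kernel l k1 k2 x)%:E)%E).
  apply: ge0_le_integral => //=.
  - move=> x; rewrite in_itv/= andbT => x1.
    by rewrite lee_fin mulr_ge0// ?invr_ge0 ?ltW// (lt_le_trans ltr01).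
  - apply/measurable_EFinP; apply: measurable_funTS; apply: measurable_funM => //.
    exact: measurable_invr.
  - by apply/measurable_EFinP; apply: measurable_funTS; exact: measurable_gig_kernel.
  - move=> x; rewrite in_itv/= andbT => x1; have x0 := lt_le_trans ltr01 x1.
    by rewrite lee_fin gig_kernelE// ler_pM2l ?invr_gt0// cw.
apply: ge0_subset_integral => //=.
- by apply/measurable_EFinP; apply: measurable_funTS; exact: measurable_gig_kernel.
- by move=> x _; rewrite lee_fin gig_kernel_ge0.
- by move=> x; rewrite /= !in_itv/= !andbT; exact: lt_le_trans.
Qed.

Lemma gig_mass_fin_left l k1 k2 : (gig_mass l k1 k2 < +oo)%E ->
  0 < k2 \/ (k2 = 0 /\ 0 < l).
Proof.
rewrite gig_mass_inv => /gig_mass_fin_right[|[-> l0]]; first by left.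
by right; split => //; rewrite -oppr_lt0.
Qed.

End gig_mass.

(** * The Bessel formula for the normalizing constant *)

Section bessel.
Context {R : realType}.
Notation mu := (@lebesgue_measure R).
Notation MR := (measurableTypeR R).
Notation D := `]0%R, +oo[%classic.
Implicit Types l k x z t : R.

Definition bessel_integrand l z t := expR (- (z * cosh t)) * cosh (l * t).

Lemma cosh_gt0 t : 0 < cosh t.
Proof. by rewrite divr_gt0// addr_gt0// expR_gt0. Qed.

Lemma continuous_cosh : continuous (@cosh R).
Proof.
move=> t; apply: cvgM; last exact: cvg_cst.
apply: cvgD; first exact: continuous_expR.
by apply: continuous_comp; [exact: continuousN|exact: continuous_expR].
Qed.

Lemma continuous_bessel_integrand l z : continuous (bessel_integrand l z).
Proof.
move=> t; apply: cvgM.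
  apply: continuous_comp; last exact: continuous_expR.
  apply: continuousN; apply: cvgM; [exact: cvg_cst|exact: continuous_cosh].
by apply: continuous_comp; [exact: mulrl_continuous|exact: continuous_cosh].
Qed.

Lemma bessel_integrand_ge0 l z t : 0 <= bessel_integrand l z t.
Proof. by rewrite mulr_ge0 ?expR_ge0 ?ltW ?cosh_gt0. Qed.

(** Adding the weights for [l] and [- l] produces the cosine hyperbolic of [l * t]. *)
Lemma gig_weight_expR l z t :
  gig_weight l (z / 2) (z / 2) (expR t) + gig_weight (- l) (z / 2) (z / 2) (expR t) =
  2 * bessel_integrand l z t.
Proof.
rewrite /gig_weight /bessel_integrand /cosh -!expRM -expRN mulrN (mulrC t).
rewrite (_ : - (z / 2 * expR t) - z / 2 * expR (- t) = - (z * ((expR t + expR (- t)) / 2))).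
  by field.
by field.
Qed.

Lemma haar_indic (A : set MR) (f : R -> \bar R) : A `<=` D ->
  haar (fun x => (\1_A x)%:E * f x)%E = (\int[mu]_(x in A) ((x^-1)%:E * f x))%E.
Proof.
move=> AD; rewrite /haar [LHS]integral_mkcond [RHS]integral_mkcond.
apply: eq_integral => x _; rewrite !patchE indicE.
have [xA|xA] := boolP (x \in A); last by rewrite mul0e mule0 if_same.
by rewrite ifT ?mul1e//; move: xA; rewrite !inE; exact: AD.
Qed.

(** For equal [k1] and [k2], inversion folds [0, 1] onto [1, +oo[ at the cost of
    negating [l]. *)
Lemma haar_split l k : haar (EFin \o gig_weight l k k) =
  (\int[mu]_(x in `[1%R, +oo[) (x^-1 * (gig_weight l k k x + gig_weight (- l) k k x))%:E)%E.
Proof.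
pose f l := (EFin \o gig_weight l k k : R -> \bar R).
have mV : measurable_fun [set: MR] (fun x : R => (x^-1)%:E).
  by apply/measurable_EFinP; exact: measurable_invr.
have mf l' : measurable_fun [set: MR] (f l').
  by apply/measurable_EFinP; exact: measurable_gig_weight.
have f0 l' x : (0 <= f l' x)%E by rewrite lee_fin gig_weight_ge0.
have mF l' : measurable_fun [set: MR] (fun x : R => (x^-1)%:E * f l' x)%E.
  exact: emeasurable_funM.
have F0 (l' x : R) : 0 < x -> (0 <= (x^-1)%:E * f l' x)%E.
  by move=> x0; rewrite mule_ge0// lee_fin invr_ge0 ltW.
have subD : `[1%R, +oo[ `<=` (D : set R) /\ `]1%R, +oo[ `<=` (D : set R) /\ `]0%R, 1%R[ `<=` (D : set R).
  split; [|split]; move=> x /=; rewrite !in_itv/= ?andbT; lra.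
have -> : haar (f l) = (\int[mu]_(x in `]0%R, 1%R[) ((x^-1)%:E * f l x) +
    \int[mu]_(x in `[1%R, +oo[) ((x^-1)%:E * f l x))%E.
  rewrite -ge0_integral_setU//.
  - by rewrite /haar; congr integral; apply/seteqP; split => x /=; rewrite !in_itv/= ?andbT;
      [case: (ltP x 1) => x1 ?; [left|right]; lra|case; lra].
  - apply: measurable_funTS; exact: mF.
  - by move=> x xD; apply: F0; move: xD => /= []; rewrite !in_itv/= ?andbT; lra.
  - apply/disj_setPS => x /= []; rewrite !in_itv/= ?andbT; lra.
have -> : (\int[mu]_(x in `]0%R, 1%R[) ((x^-1)%:E * f l x) =
    \int[mu]_(x in `[1%R, +oo[) ((x^-1)%:E * f (- l)%R x))%E.
  rewrite -(integral_itv_obnd_cbnd (r := 1)); last by apply: measurable_funTS; exact: (mF (- l)).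
  rewrite -!haar_indic; [|exact: subD.2.1|exact: subD.2.2].
  have mI : measurable_fun [set: MR] (fun x : R => (\1_`]0%R, 1%R[ x)%:E * f l x)%E.
    apply: emeasurable_funM => //; apply/measurable_EFinP.
    by apply: measurable_indic; exact: measurable_itv.
  rewrite (haar_inv mI); last by move=> x; rewrite mule_ge0// lee_fin.
  apply: eq_haar => x x0; rewrite /f /= gig_weight_inv//; congr (_%:E * _)%E.
  rewrite !indicE; congr (_%:R); congr nat_of_bool.
  by apply/idP/idP; rewrite !inE/= !in_itv/= !andbT invr_gt0 x0 invf_lt1.
rewrite -ge0_integralD//=.
- by apply: eq_integral => x _; rewrite -!EFinM -EFinD -mulrDr addrC.
- by move=> x x1; apply: F0; move: x1; rewrite /= in_itv/= andbT; lra.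
- apply: measurable_funTS; exact: mF.
- by move=> x x1; apply: F0; move: x1; rewrite /= in_itv/= andbT; lra.
- apply: measurable_funTS; exact: mF.
Qed.

(** The dilation by [sqrt (k2 / k1)] makes the two exponential rates equal to
    [sqrt (k1 * k2)]. *)
Lemma gig_mass_bessel l (k1 k2 : R) : 0 < k1 -> 0 < k2 ->
  gig_mass l k1 k2 = ((Num.sqrt (k2 / k1) `^ l * 2)%:E *
    \int[mu]_(t in D) (bessel_integrand l (2 * Num.sqrt (k1 * k2)) t)%:E)%E.
Proof.
move=> k10 k20.
set m := Num.sqrt (k2 / k1); set z := 2 * Num.sqrt (k1 * k2).
have m0 : 0 < m by rewrite sqrtr_gt0 divr_gt0.
have k1m : k1 * m = z / 2.
  rewrite /z mulrAC divff// mul1r /m.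
  rewrite (_ : k1 * k2 = k1 ^+ 2 * (k2 / k1)); last by field; rewrite gt_eqF.
  by rewrite [RHS]sqrtrM ?sqr_ge0// sqrtr_sqr gtr0_norm.
have k2m : k2 * m^-1 = z / 2.
  rewrite -k1m; apply: (mulIf (lt0r_neq0 m0)); rewrite mulfVK ?gt_eqF//.
  by rewrite -mulrA -expr2 sqr_sqrtr ?divr_ge0 ?ltW//; field; rewrite gt_eqF.
have mw l' k k' : measurable_fun [set: MR] (EFin \o gig_weight l' k k').
  by apply/measurable_EFinP; exact: measurable_gig_weight.
rewrite gig_mass_haar (haar_scale m0)//; last by move=> x; rewrite lee_fin gig_weight_ge0.
transitivity (haar (fun x => (m `^ l)%:E * (EFin \o gig_weight l (z / 2) (z / 2)) x)%E).
  apply: eq_haar => x x0 /=; rewrite -EFinM; congr EFin.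
  rewrite /gig_weight powRM ?(ltW x0) ?(ltW m0)// -mulrA; congr (_ * (_ * expR _)).
  by rewrite mulrA k1m invfM mulrA k2m.
rewrite haarZl//; last 2 first.
- by rewrite lee_fin powR_ge0.
- by move=> x; rewrite lee_fin gig_weight_ge0.
rewrite EFinM -muleA; congr (_ * _)%E; rewrite haar_split.
transitivity (\int[mu]_(x in `[1%R, +oo[) (x^-1 * (fun t => 2 * bessel_integrand l z t) (ln x))%:E)%E.
  apply: eq_integral => x; rewrite inE/= in_itv/= andbT => x1; congr (_ * _)%:E.
  by rewrite -gig_weight_expR lnK// posrE (lt_le_trans ltr01).
rewrite (@integral_log_subst _ (fun t => 2 * bessel_integrand l z t)); last 2 first.
- by move=> t; apply: cvgM; [exact: cvg_cst|exact: continuous_bessel_integrand].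
- by move=> t; rewrite mulr_ge0// bessel_integrand_ge0.
have mb : measurable_fun [set: MR] (bessel_integrand l z).
  by apply: continuous_measurable_fun; exact: continuous_bessel_integrand.
rewrite -integral_itv_obnd_cbnd; last first.
  apply/measurable_EFinP; apply: measurable_funTS.
  by apply: measurable_funM.
under eq_integral do rewrite EFinM.
rewrite ge0_integralZl//.
- by apply/measurable_EFinP; exact: measurable_funTS.
- by move=> t _; rewrite lee_fin bessel_integrand_ge0.
Qed.

(** The mass may be infinite when [k1 = 0]; where this is applied, a multiple of it is a
    total probability. *)
Lemma gig_massE l (k1 k2 : R) : 0 < k1 \/ k1 = 0 -> 0 < k2 ->
  (gig_mass l k1 k2 < +oo)%E -> gig_mass l k1 k2 = (gig_Z l k1 k2)%:E.
Proof.
move=> k10 k20 fin.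
have mass0 : (0 <= gig_mass l k1 k2)%E.
  by apply: integral_ge0 => x _; rewrite lee_fin gig_kernel_ge0.
have massf : gig_mass l k1 k2 \is a fin_num by rewrite ge0_fin_numE.
case: k10 massf => [k10 massf|-> massf]; last first.
  by rewrite /gig_Z eqxx /Rintegral fineK.
move: massf; rewrite gig_mass_bessel// /gig_Z (gt_eqF k10).
set m := Num.sqrt (k2 / k1); set z := 2 * Num.sqrt (k1 * k2).
have ml0 : 0 < m `^ l by rewrite powR_gt0// sqrtr_gt0 divr_gt0.
have -> : (k1 / k2) `^ (l / 2) = (m `^ l)^-1.
  have E : k2 / k1 = (k1 / k2) `^ (-1).
    by rewrite powR_inv1 ?invf_div// divr_ge0// ltW.
  rewrite /m -powR12_sqrt ?divr_ge0 ?ltW// E -!powRrM -powRN.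
  by congr (_ `^ _); field.
set I := (\int[mu]_(t in D) _)%E => If.
have I0 : (0 <= I)%E by apply: integral_ge0 => t _; rewrite lee_fin bessel_integrand_ge0.
have Ifin : I \is a fin_num.
  rewrite ge0_fin_numE// ltNge; apply/negP; rewrite leye_eq => /eqP Iy.
  by move: If; rewrite Iy gt0_muley// lte_fin mulr_gt0.
rewrite -(fineK Ifin).
by rewrite -EFinM /besselK /Rintegral/=; congr EFin; rewrite invrK -/z -/I; ring.
Qed.

End bessel.

(** * Images of pairs of GIG variables *)

Section gig_laws.
Context {R : realType} d (T : measurableType d) (P : probability T R).
Notation mu := (@lebesgue_measure R).
Notation MR := (measurableTypeR R).
Notation D := `]0%R, +oo[%classic.
Implicit Types (l k C : R) (A B : set R).

Definition gig_meas l (k1 k2 : R) A : \bar R :=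
  (\int[mu]_(x in A `&` D) (gig_kernel l k1 k2 x)%:E)%E.

Lemma gig_measT l (k1 k2 : R) : gig_meas l k1 k2 setT = gig_mass l k1 k2.
Proof. by rewrite /gig_meas setTI. Qed.

Lemma gig_meas_ge0 l (k1 k2 : R) A : (0 <= gig_meas l k1 k2 A)%E.
Proof. by apply: integral_ge0 => x _; rewrite lee_fin gig_kernel_ge0. Qed.

Let mkE l (k1 k2 : R) (A : set MR) : measurable_fun A (EFin \o gig_kernel l k1 k2).
Proof. by apply: measurable_funTS; apply/measurable_EFinP; exact: measurable_gig_kernel. Qed.

Lemma measurable_setI_pos A : measurable A -> measurable (A `&` D).
Proof. by move=> mA; apply: measurableI => //; exact: measurable_itv. Qed.

Lemma pos_density (X : T -> R) (f : R -> R) A : (forall w, 0 < X w) ->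
  has_density P X f -> measurable A ->
  P (X @^-1` A) = (\int[mu]_(x in A `&` D) (f x)%:E)%E.
Proof.
move=> X0 [_ _ fE] mA; rewrite -fE; last exact: measurable_setI_pos.
congr (P _); apply/seteqP; split => w /=; last by case.
by rewrite in_itv/= X0.
Qed.

Lemma pos_density_gig (X : T -> R) (f : R -> R) C l (k1 k2 : R) A :
  (forall w, 0 < X w) -> has_density P X f -> 0 <= C ->
  (forall x, 0 < x -> f x = C * gig_kernel l k1 k2 x) -> measurable A ->
  P (X @^-1` A) = (C%:E * gig_meas l k1 k2 A)%E.
Proof.
move=> X0 fX C0 fE mA; rewrite (pos_density X0 fX mA) /gig_meas -ge0_integralZl//.
- by apply: eq_integral => x; rewrite inE/= in_itv/= andbT => -[_ x0]; rewrite fE// EFinM.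
- exact: measurable_setI_pos.
- exact: mkE.
- by move=> x _; rewrite lee_fin gig_kernel_ge0.
Qed.

Lemma proportional_mass_fin (X : T -> R) C l (k1 k2 : R) : 0 <= C ->
  (forall A, measurable A -> P (X @^-1` A) = (C%:E * gig_meas l k1 k2 A)%E) ->
  (gig_mass l k1 k2 < +oo)%E.
Proof.
move=> C0 /(_ setT measurableT); rewrite preimage_setT probability_setT gig_measT.
rewrite ltNge leye_eq => e; apply/negP => /eqP oo; move: e; rewrite oo.
move: C0; rewrite le_eqVlt => /predU1P[<-|C0].
  by rewrite mul0e => /eqP; rewrite onee_eq0.
by rewrite gt0_muley ?lte_fin.
Qed.

(** The total mass 1 forces the proportionality constant to be the inverse of the
    normalizing constant, and forces [l < 0] when [k1 = 0]. *)
Lemma proportional_has_GIG (X : T -> R) C l (k1 k2 : R) :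
  0 <= C -> 0 <= k1 -> 0 < k2 ->
  (forall A, measurable A -> P (X @^-1` A) = (C%:E * gig_meas l k1 k2 A)%E) ->
  has_GIG P X l k1 k2.
Proof.
move=> C0 k10 k20 XE.
have fin := proportional_mass_fin C0 XE.
have k10' : 0 < k1 \/ k1 = 0.
  by move: k10; rewrite le_eqVlt => /predU1P[<-|]; [right|left].
have massE := gig_massE k10' k20 fin.
have /(congr1 fine) := XE setT measurableT.
rewrite preimage_setT probability_setT gig_measT massE /= => CZ.
have Z0 : gig_Z l k1 k2 != 0.
  by apply/eqP => Z0; move: CZ; rewrite Z0 mulr0 => /eqP; rewrite oner_eq0.
have CE : C = (gig_Z l k1 k2)^-1.
  by apply: (mulIf Z0); rewrite -CZ mulVf.
split=> //; first exact: gig_mass_fin_right fin.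
split.
- apply/(measurable_restrictT _ _).1; first exact: measurable_itv.
  apply: measurable_funTS; apply: measurable_funM => //.
  exact: measurable_gig_kernel.
- move=> x; rewrite /gig_pdf patchE; case: ifP => // _.
  by rewrite mulr_ge0 ?gig_kernel_ge0// -CE.
- move=> A mA; rewrite XE// /gig_meas -ge0_integralZl//; last 3 first.
  + exact: measurable_setI_pos.
  + exact: mkE.
  + by move=> x _; rewrite lee_fin gig_kernel_ge0.
  rewrite integral_mkcondr; apply: eq_integral => x _.
  by rewrite /gig_pdf !patchE CE; case: ifP.
Qed.

End gig_laws.

Section kernel_product.
Context {R : realType}.

(** The powers match because [u * v = x * y]. In the exponents,
    [c2 / x + c2 * b * y = (c2 / v) * (1 + a * s) = c2 / v + c2 * a * u], and likewise
    for [c1] with the roles exchanged. *)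
Lemma gig_kernel_F1 (a b l c1 c2 u v : R) :
  0 <= a -> 0 <= b -> 0 < u -> 0 < v ->
  gig_kernel l (c1 * a) c2 (F1 a b (u, v)).1 *
    gig_kernel l (c2 * b) c1 (F1 a b (u, v)).2 =
  gig_kernel l (c2 * a) c1 u * gig_kernel l (c1 * b) c2 v.
Proof.
move=> a0 b0 u0 v0; have [X0 Y0] := F1_gt0 a0 b0 u0 v0.
have pos c : 0 <= c -> 1 + c * u * v != 0.
  by move=> c0; rewrite gt_eqF// ltr_pwDl// !mulr_ge0// ltW.
rewrite /gig_kernel mulrACA [RHS]mulrACA -!powRM ?ltW// -!expRD.
have A0 := pos a a0; have B0 := pos b b0.
congr (_ `^ _ * expR _) => /=; first by field; rewrite A0 B0.
by field; rewrite A0 B0 !gt_eqF.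
Qed.

End kernel_product.

Section factorization.
Context {R : realType} d (T : measurableType d) (P : probability T R).
Variables (a b : R) (X Y : T -> R).
Hypotheses (a0 : 0 <= a) (b0 : 0 <= b).
Hypotheses (mX : measurable_fun [set: T] X) (mY : measurable_fun [set: T] Y).
Hypotheses (X0 : forall w, 0 < X w) (Y0 : forall w, 0 < Y w).
Hypothesis ind : independent_rv P X Y.
Notation mu := (@lebesgue_measure R).
Notation MR := (measurableTypeR R).
Notation D := `]0%R, +oo[%classic.
Let U w := (F1 a b (X w, Y w)).1.
Let V w := (F1 a b (X w, Y w)).2.

Lemma gig_joint_law (l c1 c2 : R) (A B : set R) :
  has_GIG P X l (c1 * a) c2 -> has_GIG P Y l (c2 * b) c1 ->
  measurable A -> measurable B ->
  P (U @^-1` A `&` V @^-1` B) =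
  (((gig_Z l (c1 * a) c2)^-1 * (gig_Z l (c2 * b) c1)^-1)%:E *
   (gig_meas l (c2 * a) c1 A * gig_meas l (c1 * b) c2 B))%E.
Proof.
move=> [_ _ pX] [_ _ qY] mA mB.
rewrite (F1_joint_law a0 b0 mX mY X0 Y0 pX qY ind mA mB).
set C1 := (gig_Z l (c1 * a) c2)^-1; set C2 := (gig_Z l (c2 * b) c1)^-1.
have mI l' (k k' : R) : measurable_fun [set: MR] (EFin \o gig_kernel l' k k').
  by apply/measurable_EFinP; exact: measurable_gig_kernel.
have g1 x : 0 < x -> gig_pdf l (c1 * a) c2 x = C1 * gig_kernel l (c1 * a) c2 x.
  by move=> x0; rewrite /gig_pdf patchE ifT// inE/= in_itv/= x0.
have g2 x : 0 < x -> gig_pdf l (c2 * b) c1 x = C2 * gig_kernel l (c2 * b) c1 x.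
  by move=> x0; rewrite /gig_pdf patchE ifT// inE/= in_itv/= x0.
have C0 : 0 <= C1 * C2.
  have [_ p0 _] := pX; have [_ q0 _] := qY.
  have kp k k' : 0 < gig_kernel l k k' 1 by rewrite mulr_gt0 ?powR_gt0 ?expR_gt0.
  have C10 : 0 <= C1 by have := p0 1; rewrite g1// pmulr_lge0.
  have C20 : 0 <= C2 by have := q0 1; rewrite g2// pmulr_lge0.
  exact: mulr_ge0.
transitivity (\int[mu]_(v in B `&` D) ((C1 * C2 * gig_kernel l (c1 * b) c2 v)%:E * gig_meas l (c2 * a) c1 A))%E.
  apply: eq_integral => v; rewrite inE/= in_itv/= andbT => -[_ v0].
  rewrite /gig_meas -ge0_integralZl//; last 4 first.
  - exact: measurable_setI_pos.
  - apply: measurable_funTS; exact: mI.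
  - by move=> x _; rewrite lee_fin gig_kernel_ge0.
  - by rewrite lee_fin mulr_ge0 ?gig_kernel_ge0.
  apply: eq_integral => u; rewrite inE/= in_itv/= andbT => -[_ u0].
  have [x0 y0] := F1_gt0 a0 b0 u0 v0.
  rewrite -EFinM; congr EFin; rewrite g1// g2// mulrACA gig_kernel_F1//.
  by rewrite -[RHS]mulrA [X in _ = _ * X]mulrC.
under eq_integral do rewrite EFinM -muleA [X in (_ * X)%E]muleC.
have IA0 := gig_meas_ge0 l (c2 * a) c1 A.
rewrite ge0_integralZl//; last 3 first.
- exact: measurable_setI_pos.
- by apply: measurable_funTS; apply: emeasurable_funM => //; exact: mI.
- by move=> x _; rewrite mule_ge0// lee_fin gig_kernel_ge0.
congr (_ * _)%E; rewrite ge0_integralZl//.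
- exact: measurable_setI_pos.
- apply: measurable_funTS; exact: mI.
- by move=> x _; rewrite lee_fin gig_kernel_ge0.
Qed.

(** An infinite factor would make the product 0 or infinite. *)
Lemma mule_eq1_fin (c : R) (i j : \bar R) : (0 <= i)%E -> (0 <= j)%E -> 0 <= c ->
  (c%:E * (i * j) = 1)%E -> i \is a fin_num /\ j \is a fin_num.
Proof.
have oo (x : \bar R) : (0 <= x)%E -> (x * +oo != 1)%E.
  rewrite le_eqVlt => /predU1P[<-|x0]; first by rewrite mul0e eq_sym onee_eq0.
  by rewrite gt0_muley.
move=> i0 j0 c0 e; split; rewrite ge0_fin_numE// ltNge leye_eq; apply/negP => /eqP y.
- by move: e => /eqP; apply/negP; rewrite y muleCA muleC oo// mule_ge0.
- by move: e => /eqP; apply/negP; rewrite y muleA oo// mule_ge0.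
Qed.

(** With [c * (i * j)] the mass of a rectangle and 1 the total mass, the right side is the
    product of the two marginal masses. *)
Lemma mule_marginals (c i j i1 j1 : \bar R) : (c * (i1 * j1) = 1 ->
  c * (i * j) = (c * j1 * i) * (c * i1 * j))%E.
Proof.
move=> e; rewrite -[LHS]mule1 -e muleACA -(muleA c j1) -(muleA c i1) [RHS]muleACA.
by congr (_ * _)%E; rewrite (muleC j1 i) [RHS]muleACA (muleC j1 j) [LHS]muleACA.
Qed.

Lemma gig_F1 (l c1 c2 : R) : 0 < c1 -> 0 < c2 ->
  has_GIG P X l (c1 * a) c2 -> has_GIG P Y l (c2 * b) c1 ->
  [/\ independent_rv P U V, has_GIG P U l (c2 * a) c1 & has_GIG P V l (c1 * b) c2].
Proof.
move=> c10 c20 gX gY.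
have JL := gig_joint_law gX gY.
set C := _ * _ in JL; clearbody C.
set I := gig_meas l (c2 * a) c1 in JL; set J := gig_meas l (c1 * b) c2 in JL.
have one : (C%:E * (I setT * J setT) = 1)%E.
  by rewrite -JL// !preimage_setT setIT probability_setT.
have C0 : 0 <= C.
  rewrite leNgt; apply/negP => C0.
  have : (C%:E * (I setT * J setT) <= 0)%E.
    by rewrite mule_le0_ge0 ?mule_ge0 ?gig_meas_ge0// lee_fin ltW.
  by rewrite one leNgt lte01.
have [Ifin Jfin] := mule_eq1_fin (gig_meas_ge0 _ _ _ _) (gig_meas_ge0 _ _ _ _) C0 one.
have PU A : measurable A -> P (U @^-1` A) = ((C * fine (J setT))%:E * I A)%E.
  move=> mA; have := JL A setT mA measurableT; rewrite preimage_setT setIT => ->.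
  by rewrite EFinM (fineK Jfin) -muleA [(J _ * _)%E]muleC.
have PV B : measurable B -> P (V @^-1` B) = ((C * fine (I setT))%:E * J B)%E.
  move=> mB; have := JL setT B measurableT mB; rewrite preimage_setT setTI => ->.
  by rewrite EFinM (fineK Ifin) -muleA.
split.
- move=> A B mA mB; rewrite JL// PU// PV//.
  rewrite EFinM [in RHS](EFinM C) (fineK Ifin) (fineK Jfin).
  exact: mule_marginals.
- apply: proportional_has_GIG PU => //.
  + by rewrite mulr_ge0// fine_ge0// gig_meas_ge0.
  + by rewrite mulr_ge0// ltW.
- apply: proportional_has_GIG PV => //.
  + by rewrite mulr_ge0// fine_ge0// gig_meas_ge0.
  + by rewrite mulr_ge0// ltW.
Qed.

End factorization.

(** * The characterization *)

Section characterization.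
Context {R : realType} d (T : measurableType d) (P : probability T R).
Variables (a b : R) (X Y : T -> R) (p q : R -> R).
Hypotheses (a0 : 0 <= a) (b0 : 0 <= b) (ab : a != b).
Hypotheses (mX : measurable_fun [set: T] X) (mY : measurable_fun [set: T] Y).
Hypotheses (X0 : forall w, 0 < X w) (Y0 : forall w, 0 < Y w).
Hypothesis ind : independent_rv P X Y.
Hypotheses (pX : has_density P X p) (qY : has_density P Y q).
Hypothesis sp : forall x, 0 < x ->
  [/\ 0 < p x, derivable p x 1 & derivable (derive1 p) x 1].
Hypothesis sq : forall x, 0 < x ->
  [/\ 0 < q x, derivable q x 1 & derivable (derive1 q) x 1].

Lemma smooth_continuous (f : R -> R) : (forall x, 0 < x ->
    [/\ 0 < f x, derivable f x 1 & derivable (derive1 f) x 1]) ->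
  forall x : R, 0 < x -> {for x, continuous f}.
Proof.
move=> sf x x0; have [_ df _] := sf x x0.
by apply: differentiable_continuous; exact/derivable1_diffP.
Qed.

Lemma smooth_ln (f : R -> R) : (forall x, 0 < x ->
    [/\ 0 < f x, derivable f x 1 & derivable (derive1 f) x 1]) ->
  exists (f1 f2 : R -> R), (forall x : R, 0 < x -> is_derive x 1 (@ln R \o f) (f1 x)) /\
     (forall x : R, 0 < x -> is_derive x 1 f1 (f2 x)).
Proof.
move=> sf.
pose f1 x := (f x)^-1 * derive1 f x.
exists f1, (derive1 f1); split => x x0; have [fx df ddf] := sf x x0.
  have dfx : is_derive x 1 f (derive1 f x) by split; [exact: df|rewrite derive1E].
  exact: (@is_derive1_comp _ (@ln R) f x _ _ (is_derive1_ln fx) dfx).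
split; last by rewrite derive1E.
apply: derivableM; last exact: ddf.
by apply: derivableV; [rewrite gt_eqF|exact: df].
Qed.

(** The signs of [c1] and [c2] come from integrability. If [c1 = 0], then the mass of
    the law of [Y] near 0 requires [0 < l] while the mass of that of [X] at infinity
    requires [l < 0]; the case [c2 = 0] is symmetric. *)
Lemma independent_F1_gig_form :
  independent_rv P (fun w => (F1 a b (X w, Y w)).1) (fun w => (F1 a b (X w, Y w)).2) ->
  exists l c1 c2 C1 C2, [/\ 0 < c1, 0 < c2, 0 < C1 /\ 0 < C2 &
    forall x, 0 < x -> p x = C1 * gig_kernel l (c1 * a) c2 x /\
                       q x = C2 * gig_kernel l (c2 * b) c1 x].
Proof.
move=> indUV.
have jsep := independent_F1_separable a0 b0 mX mY X0 Y0 pX qY ind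
  (smooth_continuous sp) (smooth_continuous sq) indUV.
have [p1 [p2 [dp1 dp2]]] := smooth_ln sp.
have [q1 [q2 [dq1 dq2]]] := smooth_ln sq.
have lsep : F1_separable a b (@ln R \o p) (@ln R \o q).
  have pos u v : 0 < u -> 0 < v -> 0 < p (F1 a b (u, v)).1 /\ 0 < q (F1 a b (u, v)).2.
    move=> u0 v0; have [x0 y0] := F1_gt0 a0 b0 u0 v0.
    by have [? _ _] := sp x0; have [? _ _] := sq y0.
  move=> u v u' v' u0 v0 u'0 v'0.
  have := jsep u v u' v' u0 v0 u'0 v'0 => /(congr1 (@ln R)).
  have [p_uv q_uv] := pos u v u0 v0; have [p_uv' q_uv'] := pos u v' u0 v'0.
  have [p_u'v q_u'v] := pos u' v u'0 v0; have [p_u'v' q_u'v'] := pos u' v' u'0 v'0.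
  by rewrite !lnM ?posrE ?mulr_gt0.
have [L [c1 [c2 [k1 [k2 pq]]]]] := F1_separable_log_gig a0 b0 ab dp1 dp2 dq1 dq2 lsep.
pose l := L + 1.
have expE (f : R -> R) k k' k'' x : 0 < x -> 0 < f x -> (@ln R \o f) x = k + L * ln x - k' * x - k'' / x ->
    f x = expR k * gig_kernel l k' k'' x.
  move=> x0 fx /= e; rewrite -[LHS]lnK ?posrE// e /gig_kernel /l addrK /powR gt_eqF//.
  by rewrite -!expRD !addrA.
have pE x : 0 < x -> p x = expR k1 * gig_kernel l (c1 * a) c2 x.
  by move=> x0; have [px _ _] := sp x0; apply: expE => //; have [] := pq x x0.
have qE x : 0 < x -> q x = expR k2 * gig_kernel l (c2 * b) c1 x.
  by move=> x0; have [qx _ _] := sq x0; apply: expE => //; have [] := pq x x0.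
have finX := proportional_mass_fin (expR_ge0 k1)
  (fun A => pos_density_gig X0 pX (expR_ge0 k1) pE).
have finY := proportional_mass_fin (expR_ge0 k2)
  (fun A => pos_density_gig Y0 qY (expR_ge0 k2) qE).
have Xr := gig_mass_fin_right finX; have Xl := gig_mass_fin_left finX.
have Yr := gig_mass_fin_right finY; have Yl := gig_mass_fin_left finY.
have c10 : 0 < c1.
  case: Yl => // -[c10 l0]; case: Xr => [|[_ l1]]; first by rewrite c10 mul0r ltxx.
  by have := lt_trans l0 l1; rewrite ltxx.
have c20 : 0 < c2.
  case: Xl => // -[c20 l0]; case: Yr => [|[_ l1]]; first by rewrite c20 mul0r ltxx.
  by have := lt_trans l0 l1; rewrite ltxx.
exists l, c1, c2, (expR k1), (expR k2); split => //; first by rewrite !expR_gt0.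
by move=> x x0; rewrite pE// qE.
Qed.

Lemma independent_F1_has_GIG :
  independent_rv P (fun w => (F1 a b (X w, Y w)).1) (fun w => (F1 a b (X w, Y w)).2) ->
  exists l c1 c2 C1 C2, [/\ 0 < c1, 0 < c2,
    has_GIG P X l (c1 * a) c2 /\ has_GIG P Y l (c2 * b) c1, 0 < C1 /\ 0 < C2 &
    forall x, 0 < x -> p x = C1 * gig_kernel l (c1 * a) c2 x /\
                       q x = C2 * gig_kernel l (c2 * b) c1 x].
Proof.
move=> /independent_F1_gig_form[l [c1 [c2 [C1 [C2 [c10 c20 [C10 C20] pq]]]]]].
exists l, c1, c2, C1, C2; split => //; split.
- apply: (proportional_has_GIG (ltW C10) (mulr_ge0 (ltW c10) a0) c20) => A mA.
  apply: (pos_density_gig X0 pX (ltW C10)) => //.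
  by move=> x x0; have [] := pq x x0.
- apply: (proportional_has_GIG (ltW C20) (mulr_ge0 (ltW c20) b0) c10) => A mA.
  apply: (pos_density_gig Y0 qY (ltW C20)) => //.
  by move=> x x0; have [] := pq x x0.
Qed.

Lemma same_law_independent :
  same_law P (fun w => F1 a b (X w, Y w)) (fun w => (X w, Y w)) ->
  independent_rv P (fun w => (F1 a b (X w, Y w)).1) (fun w => (F1 a b (X w, Y w)).2).
Proof.
move=> sl A B mA mB.
have box A' B' : measurable A' -> measurable B' ->
    P ((fun w => (F1 a b (X w, Y w)).1) @^-1` A' `&`
       (fun w => (F1 a b (X w, Y w)).2) @^-1` B') = (P (X @^-1` A') * P (Y @^-1` B'))%E.
  move=> mA' mB'; rewrite -ind//; exact: (sl (A' `*` B') (measurableX mA' mB')).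
rewrite box//; congr (_ * _)%E.
- have := box A setT mA measurableT.
  by rewrite !preimage_setT setIT probability_setT mule1.
- have := box setT B measurableT mB.
  by rewrite !preimage_setT setTI probability_setT mul1e.
Qed.

(** Both sides are the limits of the same probabilities of boxes, once for (U, V) and once
    for (X, Y). The latter pair is also an image under F1, with zero parameters: F1 0 0
    exchanges the coordinates, so it maps (Y, X) to (X, Y). *)
Lemma same_law_densities u v : 0 < u -> 0 < v ->
  same_law P (fun w => F1 a b (X w, Y w)) (fun w => (X w, Y w)) ->
  p (F1 a b (u, v)).1 * q (F1 a b (u, v)).2 = p u * q v.
Proof.
move=> u0 v0 sl.
have indC : independent_rv P Y X.
  by move=> A B mA mB; rewrite setIC ind// muleC.
have F00 (x y : R) : F1 0 0 (x, y) = (y, x).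
  by rewrite /F1/= !mul0r !addr0 !mulr1 !divr1.
have l1 := cvg_F1_box a0 b0 mX mY X0 Y0 pX qY ind (smooth_continuous sp) (smooth_continuous sq) u0 v0.
have l2 := cvg_F1_box (lexx 0) (lexx 0) mY mX Y0 X0 qY pX indC (smooth_continuous sq) (smooth_continuous sp) u0 v0.
rewrite F00 /= [q v * _]mulrC in l2.
apply: (@cvg_unique _ (@Rhausdorff R) _ _ _ _ l1); apply: cvg_trans l2.
apply: near_eq_cvg; near=> e.
congr (fine _ / _).
have mI x : measurable `[x - e, x + e]%classic by exact: measurable_itv.
have H := sl (`[u - e, u + e] `*` `[v - e, v + e]) (measurableX (mI u) (mI v)).
apply: (etrans _ (esym H)); congr (P _).
by apply/seteqP; split => w; rewrite /preimage/= !mul0r !addr0 !mulr1 !divr1.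
Unshelve. all: end_near.
Qed.

(** At the point (1, 1) the equality of the two densities reads
    [(c2 - c1) * (a - b) = 0]. *)
Lemma same_law_GIG :
  same_law P (fun w => F1 a b (X w, Y w)) (fun w => (X w, Y w)) ->
  exists l c, [/\ 0 < c, has_GIG P X l (c * a) c & has_GIG P Y l (c * b) c].
Proof.
move=> sl.
have [l [c1 [c2 [C1 [C2 [c10 c20 [gX gY] [C10 C20] pq]]]]]] :=
  independent_F1_has_GIG (same_law_independent sl).
suff c12 : c1 = c2 by move: gX gY; rewrite c12 => gX gY; exists l, c2.
have [x0 y0] := F1_gt0 a0 b0 (@ltr01 R) (@ltr01 R).
have := same_law_densities ltr01 ltr01 sl.
rewrite (pq _ x0).1 (pq _ y0).2 (pq _ ltr01).1 (pq _ ltr01).2.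
rewrite mulrACA gig_kernel_F1// [RHS]mulrACA.
move/(mulfI (mulf_neq0 (lt0r_neq0 C10) (lt0r_neq0 C20))).
rewrite /gig_kernel powR1 !mul1r -!expRD => /expR_inj e.
have : (c2 - c1) * (a - b) = 0 by rewrite invr1 in e; lra.
move=> /eqP; rewrite mulf_eq0 !subr_eq0 (negbTE ab) orbF => /eqP ->//.
Qed.

End characterization.

Theorem theorem1p1 (d : measure_display) (T : measurableType d) (R : realType)
    (P : probability T R) (alpha beta : R) (X Y : {RV P >-> R})
    (alpha_ge0 : 0 <= alpha) (beta_ge0 : 0 <= beta) (alpha_beta : alpha != beta)
    (X_gt0 : forall w, 0 < X w) (Y_gt0 : forall w, 0 < Y w)
    (XY_indep : independent_rv P X Y)
    (X_dens : smooth_positive_density P X)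
    (Y_dens : smooth_positive_density P Y) :
  let XY : T -> R * R := fun w => (X w, Y w) in
  let UV : T -> R * R := fun w => F1 alpha beta (XY w) in
  let U : T -> R := fun w => (UV w).1 in
  let V : T -> R := fun w => (UV w).2 in
  [/\ independent_rv P U V <->
        (exists l c1 c2 : R,
          [/\ 0 < c1, 0 < c2,
              has_GIG P X l (c1 * alpha) c2 & has_GIG P Y l (c2 * beta) c1]),
      (forall l c1 c2 : R, 0 < c1 -> 0 < c2 ->
        has_GIG P X l (c1 * alpha) c2 -> has_GIG P Y l (c2 * beta) c1 ->
        has_GIG P U l (c2 * alpha) c1 /\ has_GIG P V l (c1 * beta) c2) &
      (same_law P UV XY ->
        exists l c : R,
          [/\ 0 < c, has_GIG P X l (c * alpha) c & has_GIG P Y l (c * beta) c])].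
Proof.
move=> XY UV U V.
have [p [pX sp]] := X_dens; have [q [qY sq]] := Y_dens.
have mX : measurable_fun [set: T] X by exact: measurable_funP.
have mY : measurable_fun [set: T] Y by exact: measurable_funP.
have gigF l c1 c2 (c10 : 0 < c1) (c20 : 0 < c2) :=
  @gig_F1 _ _ _ P _ _ X Y alpha_ge0 beta_ge0 mX mY X_gt0 Y_gt0 XY_indep l c1 c2 c10 c20.
split.
- split.
  + move=> /(independent_F1_has_GIG alpha_ge0 beta_ge0 alpha_beta mX mY X_gt0 Y_gt0 XY_indep pX qY sp sq).
    by move=> [l [c1 [c2 [_ [_ [c10 c20 [gX gY] _ _]]]]]]; exists l, c1, c2.
  + by move=> [l [c1 [c2 [c10 c20 gX gY]]]]; have [] := gigF l c1 c2 c10 c20 gX gY.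
- by move=> l c1 c2 c10 c20 gX gY; have [] := gigF l c1 c2 c10 c20 gX gY.
- exact: (same_law_GIG alpha_ge0 beta_ge0 alpha_beta mX mY X_gt0 Y_gt0 XY_indep pX qY sp sq).
Qed.
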